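(* Let $G$ be an ample groupoid with compact unit space $G^{(0)}$. If $|G(x)|\geq 3$ for every $x\in G^{(0)}$, then the closed linear span $$\overline{\operatorname{span}}\{1-1_U\in \mathrm{C}^*(G) \mid U\in[[G]]\}$$ is a hereditary $\mathrm{C}^*$-subalgebra of $\mathrm{C}^*(G)$.
   Context: A topological groupoid $G$ is ample if it is locally compact, Hausdorff, étale (the range and source maps $r,s\colon G\to G$ are local homeomorphisms onto $G^{(0)}$) and its unit space $G^{(0)}$ is totally disconnected. The orbit of $x\in G^{(0)}$ is $G(x):=r(s^{-1}(x))$. A bisection is a subset $U\subset G$ such that $r|_U$ and $s|_U$ are injective. For $G$ ample with compact unit space, the topological full group $[[G]]$ is the group of compact open bisections $U$ with $r(U)=s(U)=G^{(0)}$, with product $UV=\{uv\mid u\in U, v\in V, s(u)=r(v)\}$, inverse $U^{-1}=\{u^{-1}\mid u\in U\}$ and identity $G^{(0)}$. $C_c(G)$ is the $*$-algebra of continuous compactly supported complex functions on $G$ with $(f\star g)(\gamma)=\sum_{\alpha\beta=\gamma}f(\alpha)g(\beta)$ and $f^*(\gamma)=\overline{f(\gamma^{-1})}$. $\mathrm{C}^*(G)$ is the full groupoid $\mathrm{C}^*$-algebra (the completion of $C_c(G)$ in the universal $\mathrm{C}^*$-norm). $1_U\in C_c(G)\subset \mathrm{C}^*(G)$ is the indicator function of $U$, and $1=1_{G^{(0)}}$ is the unit. *)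

(* Defs.v *)
From HB Require Import structures.
From mathcomp Require Import all_boot all_order all_algebra.
From mathcomp Require Import complex.
From mathcomp Require Import all_classical all_reals all_analysis.
Set Implicit Arguments.
Unset Strict Implicit.
Unset Printing Implicit Defensive.
Import Order.TTheory GRing.Theory Num.Theory.
Import numFieldNormedType.Exports.
Local Open Scope classical_set_scope.
Local Open Scope ring_scope.
Local Open Scope complex_scope.

(* A groupoid on the set of arrows G, with units identified with identity
   arrows.  The product is a total function whose values are only meaningful
   on composable pairs. *)
Record groupoid (G : Type) := Groupoid {
  src : G -> G;
  rng : G -> G;
  gmul : G -> G -> G;
  ginv : G -> G;
  src_src : forall x, src (src x) = src x;
  rng_src : forall x, rng (src x) = src x;
  src_rng : forall x, src (rng x) = rng x;
  rng_rng : forall x, rng (rng x) = rng x;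
  src_mul : forall x y, src x = rng y -> src (gmul x y) = src y;
  rng_mul : forall x y, src x = rng y -> rng (gmul x y) = rng x;
  gmulA : forall x y z, src x = rng y -> src y = rng z ->
    gmul x (gmul y z) = gmul (gmul x y) z;
  gmul_rng : forall x, gmul (rng x) x = x;
  gmul_src : forall x, gmul x (src x) = x;
  src_inv : forall x, src (ginv x) = rng x;
  rng_inv : forall x, rng (ginv x) = src x;
  gmulV : forall x, gmul x (ginv x) = rng x;
  gmulVx : forall x, gmul (ginv x) x = src x
}.

Section Groupoids.
Context {G : topologicalType}.
Implicit Types (g : groupoid G) (f : G -> G).

Definition unit_space g : set G := [set x | src g x = x].

Definition composable g : set (G * G) := [set p | src g p.1 = rng g p.2].

Definition topological_groupoid g :=
  {within composable g, continuous (fun p => gmul g p.1 p.2)} /\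
  continuous (ginv g).

(* f is a local homeomorphism from G onto the subspace B; the inverse h of the
   restriction of f to U is only constrained on f @` U. *)
Definition local_homeomorphism_onto f (B : set G) :=
  f @` setT = B /\
  forall x, exists U : set G, [/\ open U, U x,
    {within U, continuous f},
    exists W, open W /\ f @` U = W `&` B &
    exists h : G -> G, (forall y, U y -> h (f y) = y) /\
      {within f @` U, continuous h}].

Definition etale g :=
  local_homeomorphism_onto (rng g) (unit_space g) /\
  local_homeomorphism_onto (src g) (unit_space g).

Definition ample g :=
  [/\ topological_groupoid g, locally_compact [set: G], hausdorff_space G,
      etale g & totally_disconnected (unit_space g)].

Definition gorbit g (x : G) : set G := rng g @` (src g @^-1` [set x]).

Definition bisection g (U : set G) :=
  set_inj U (rng g) /\ set_inj U (src g).

Definition topological_full_group g : set (set G) :=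
  [set U | [/\ bisection g U, compact U, open U,
               rng g @` U = unit_space g & src g @` U = unit_space g]].

End Groupoids.

(* C*-algebras over R[i], not assumed unital; the norm takes its values in
   R[i].  The product is a separate operation because MathComp has no join of
   its ring and normed module structures. *)
HB.mixin Record isCStar (R : realType) A of CompleteNormedModule R[i] A := {
  cmul : A -> A -> A;
  star : A -> A;
  cmulA : associative cmul;
  cmulDl : left_distributive cmul +%R;
  cmulDr : right_distributive cmul +%R;
  cmulZl : forall (c : R[i]) (x y : A), cmul (c *: x) y = c *: cmul x y;
  cmulZr : forall (c : R[i]) (x y : A), cmul x (c *: y) = c *: cmul x y;
  starK : involutive star;
  starD : forall x y : A, star (x + y) = star x + star y;
  starZ : forall (c : R[i]) (x : A), star (c *: x) = c^* *: star x;
  starM : forall x y : A, star (cmul x y) = cmul (star y) (star x);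
  cnormM : forall x y : A, `|cmul x y| <= `|x| * `|y|;
  cstar_identity : forall x : A, `|cmul (star x) x| = `|x| ^+ 2
}.

#[short(type="cstarAlgType")]
HB.structure Definition CStarAlgebra (R : realType) :=
  {A of CompleteNormedModule R[i] A & isCStar R A}.

Section CStarSubsets.
Context {R : realType} {A : cstarAlgType R}.
Implicit Types (a b : A) (S : set A).

Definition cstar_positive a := exists x : A, a = cmul (star x) x.

Definition cstar_le a b := cstar_positive (b - a).

Definition cstar_subalgebra S :=
  [/\ closed S, S 0,
      forall (c : R[i]) a b, S a -> S b -> S (c *: a + b),
      forall a b, S a -> S b -> S (cmul a b) &
      forall a, S a -> S (star a)].

Definition hereditary_cstar_subalgebra S :=
  cstar_subalgebra S /\
  forall a b, cstar_positive a -> S b -> cstar_le a b -> S a.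

Definition linear_span S : set A :=
  [set x | exists n (c : 'I_n -> R[i]) (u : 'I_n -> A),
     (forall i, S (u i)) /\ x = \sum_(i < n) c i *: u i].

Definition closed_span S : set A := closure (linear_span S).

End CStarSubsets.

Section GroupoidCStar.
Context {R : realType} {G : topologicalType}.
Implicit Types (g : groupoid G) (f : G -> R[i]).

Definition Cc : set (G -> R[i]) :=
  [set f | continuous (f : G -> R[i]^o) /\ compact (closure [set x | f x != 0])].

(* For an etale groupoid and f1, f2 in Cc the sum has finite support. *)
Definition convolution g f1 f2 : G -> R[i] := fun x =>
  \sum_(p \in composable g `&` [set p | gmul g p.1 p.2 = x]) f1 p.1 * f2 p.2.

Definition fstar g f : G -> R[i] := fun x => (f (ginv g x))^*.

(* Only the values of pi on Cc are constrained. *)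
Definition star_morphism g (B : cstarAlgType R) (pi : (G -> R[i]) -> B) :=
  [/\ forall (c : R[i]) f1 f2, Cc f1 -> Cc f2 ->
        pi (fun x => c * f1 x + f2 x) = c *: pi f1 + pi f2,
      forall f1 f2, Cc f1 -> Cc f2 ->
        pi (convolution g f1 f2) = cmul (pi f1) (pi f2) &
      forall f, Cc f -> pi (fstar g f) = star (pi f)].

(* The supremum of the norms of f under all *-homomorphisms from Cc to
   C*-algebras. *)
Definition universal_norm g f : \bar R :=
  ereal_sup [set r | exists (B : cstarAlgType R) (pi : (G -> R[i]) -> B),
     star_morphism g pi /\ r = (complex.Re `|pi f|)%:E].

(* A, together with iota : Cc -> A, is the completion of Cc in the universal
   C*-norm; this determines (A, iota) up to isometric *-isomorphism. *)
Definition is_full_groupoid_cstar g (A : cstarAlgType R)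
    (iota : (G -> R[i]) -> A) :=
  [/\ star_morphism g iota,
      forall f, Cc f -> (complex.Re `|iota f|)%:E = universal_norm g f &
      closure (iota @` Cc) = setT].

End GroupoidCStar.

(* Main.v *)
Require Import Defs.
From HB Require Import structures.
From mathcomp Require Import all_boot all_order all_algebra.
From mathcomp Require Import complex.
From mathcomp Require Import all_classical all_reals all_analysis.
From mathcomp Require Import ring lra.
From Stdlib Require Algebra_syntax Ncring Ncring_tac.
Set Implicit Arguments.
Unset Strict Implicit.
Unset Printing Implicit Defensive.
Import Order.TTheory GRing.Theory Num.Theory.
Import numFieldNormedType.Exports.
Local Open Scope classical_set_scope.
Local Open Scope card_scope.
Local Open Scope ring_scope.

(** Write [M] for the closed span of the elements [1 - 1_V], with [V] in the
topological full group. It is a self-adjoint subalgebra because the full group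
is a group: [(1 - 1_V) (1 - 1_W) = (1 - 1_V) + (1 - 1_W) - (1 - 1_{VW})]. What
has to be understood is why [M] is hereditary, and this comes in two halves.

Heredity reduces to the corner property: [m t m'] lies in [M] for all [m], [m']
in [M] and every [t] ([hereditary_of_corner]). Indeed, let [a = star x * x] and
[b = a + star y * y] with [b] in [M], rescaled so that its norm is at most [1].
The elements [e_n = 1 - (1 - b)^n] lie in [M], and
[|x (1 - e_n)|^2 = |(1 - e_n) a (1 - e_n)| <= |(1 - e_n) b (1 - e_n)|]
tends to [0], so that [a] is the limit of the elements [e_n a e_n] of [M]. The
inequality needs two facts: elements of the form [star x * x] form a cone
([posc_star_mul]), on which the norm is monotone ([posc_mono]). They are derived
here without spectral theory, from square roots given by a fixed point iteration
([sqrt_compl_ex]): positivity of [p] is read off from [|t - p| <= t].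

For the corner property, the indicators [1_W] of compact open bisections span a
dense subspace ([rho_dense]), so it is enough to put [(1 - 1_V) 1_W (1 - 1_V')]
into [M], and [W] can be taken as small as one likes ([chi_compl]). With [N] the
source of [W], the element is then a difference of two elements
[(1_N - 1_B) star (1_N - 1_C)] where [B] and [C] are bisections with source
[N], a small neighbourhood of a unit [x]. If [B = C] has a range disjoint from
[N], this is [1 - 1_S] for the involution [S] that exchanges [N] and the range of
[B] ([augmentation_diag]). As [M] absorbs multiplication by the full group, one
may multiply by another involution, exchanging the ranges of two bisections [C]
and [B] out of [N]: it turns [1_X - 1_C] into [1_X - 1_B] for every [X] with range
disjoint from both ([augmentation_swap]). Since the orbit of [x] has at least
three points, there are two arrows out of [x] whose ranges differ from [x] and
from each other, and this leaves enough room to reach every [B]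
([small_reach]) and, by taking adjoints, every [C] ([small_corner]). *)

(** * Real-valued norms and closed subspaces *)
Section RealNorm.
Local Open Scope complex_scope.
Context {R : realType}.
Implicit Types V W : normedModType R[i].

(** Norms over [R[i]] take values in [R[i]]; estimates are carried out in the
totally ordered field [R]. *)
Definition nrm V (x : V) : R := complex.Re `|x|.

Lemma normE V (x : V) : `|x| = (nrm x)%:C.
Proof. rewrite /nrm RRe_real// ger0_real ?normr_ge0. Qed.

Lemma nrm_ge0 V (x : V) : 0 <= nrm x.
Proof. by rewrite -lecR -normE normr_ge0. Qed.

Lemma nrm0 V : nrm (0 : V) = 0.
Proof. by rewrite /nrm normr0. Qed.

Lemma nrm_eq0 V (x : V) : nrm x = 0 -> x = 0.
Proof. by move=> x0; apply/normr0_eq0; rewrite normE x0. Qed.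

Lemma nrmN V (x : V) : nrm (- x) = nrm x.
Proof. by rewrite /nrm normrN. Qed.

Lemma nrmC V (x y : V) : nrm (x - y) = nrm (y - x).
Proof. by rewrite -nrmN opprB. Qed.

Lemma nrmD V (x y : V) : nrm (x + y) <= nrm x + nrm y.
Proof. by rewrite -lecR rmorphD /= -!normE ler_normD. Qed.

Lemma nrmB V (x y : V) : nrm (x - y) <= nrm x + nrm y.
Proof. by apply: le_trans (nrmD _ _) _; rewrite nrmN. Qed.

Lemma nrmZ V (c : R[i]) (x : V) : nrm (c *: x) = complex.Re `|c| * nrm x.
Proof.
by apply: complexI; rewrite -normE normrZ normE rmorphM /= RRe_real // ger0_real ?normr_ge0.
Qed.

Lemma nrmZr V (t : R) (x : V) : nrm (t%:C *: x) = `|t| * nrm x.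
Proof. by rewrite nrmZ normc_def /= expr0n addr0 sqrtr_sqr. Qed.

Lemma nrmMn V (x : V) n : nrm (x *+ n) = nrm x *+ n.
Proof. by apply: complexI; rewrite -normE normrMn rmorphMn /= -normE. Qed.

Lemma nbhs_nrmP V (x : V) (S : set V) :
  nbhs x S <-> exists2 e : R, 0 < e & forall y, nrm (x - y) < e -> S y.
Proof.
rewrite -nbhs_nbhs_norm; split=> [[e /= e0 eS]|[e e0 eS]].
  have eE : e = (complex.Re e)%:C by rewrite RRe_real// gtr0_real.
  exists (complex.Re e); first by rewrite -ltcR -eE.
  by move=> y xy; apply: eS; rewrite /= normE eE ltcR.
exists e%:C; first by rewrite /= ltcR.
by move=> y /=; rewrite normE ltcR; apply: eS.
Qed.

Lemma closure_nrmP V (S : set V) (x : V) :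
  closure S x <-> forall e : R, 0 < e -> exists2 y, S y & nrm (x - y) < e.
Proof.
split=> [Sx e e0|Sx B /nbhs_nrmP[e e0 eB]].
  have /Sx[y [Sy xy]] : nbhs x [set y | nrm (x - y) < e].
    by apply/nbhs_nrmP; exists e.
  by exists y.
by have [y Sy xy] := Sx _ e0; exists y; split => //; apply: eB.
Qed.

(** Completeness with an explicit modulus [b], which the limit inherits. *)
Lemma nrm_complete (V : completeNormedModType R[i]) (u : nat -> V) (b : nat -> R) :
  (forall e : R, 0 < e -> exists n, b n < e) ->
  (forall n m, (n <= m)%N -> nrm (u m - u n) <= b n) ->
  exists l, forall n, nrm (l - u n) <= b n.
Proof.
move=> b0 ub.
have uc : cauchy (u @ \oo).
  apply/cauchyP => e e0.
  have eE : e = (complex.Re e)%:C by rewrite RRe_real// gtr0_real.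
  have /b0[n bn] : 0 < complex.Re e by rewrite -ltcR -eE.
  exists (u n), n => // m /= nm.
  rewrite /= -ball_normE /= normE eE ltcR nrmC; apply: le_lt_trans bn.
  exact: ub.
have [l ul] := (cvg_ex _).1 (cauchy_cvg _ uc).
exists l => n; apply/ler_addgt0Pr => e e0.
have : nbhs l [set y | nrm (l - y) < e] by apply/nbhs_nrmP; exists e.
move=> /ul[N _ Nl].
have := Nl (maxn n N) (leq_maxr _ _) => /= lN.
rewrite -(subrKA (u (maxn n N))) addrC.
apply: le_trans (nrmD _ _) _; rewrite lerD ?(ltW lN)//.
by apply: ub; rewrite leq_maxl.
Qed.

Definition closed_subspace V (S : set V) :=
  [/\ closed S, S 0 & forall (c : R[i]) a b, S a -> S b -> S (c *: a + b)].

Section ClosedSubspace.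
Context {V : normedModType R[i]} (S : set V) (hS : closed_subspace S).

Lemma csubD a b : S a -> S b -> S (a + b).
Proof. by case: hS => _ _ h Sa Sb; have := h 1 _ _ Sa Sb; rewrite scale1r. Qed.

Lemma csubZ c a : S a -> S (c *: a).
Proof. by case: hS => _ S0 h Sa; have := h c _ _ Sa S0; rewrite addr0. Qed.

Lemma csubB a b : S a -> S b -> S (a - b).
Proof. by move=> Sa Sb; apply: csubD => //; rewrite -scaleN1r; apply: csubZ. Qed.

Lemma csub_sum n (F : 'I_n -> V) : (forall i, S (F i)) -> S (\sum_i F i).
Proof.
case: (hS) => _ S0 _ SF; apply: (big_ind (fun x => S x)) => //.
by move=> *; apply: csubD.
Qed.

Lemma csub_lim a : (forall e : R, 0 < e -> exists2 y, S y & nrm (a - y) < e) -> S a.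
Proof. by case: hS => cS _ _ /closure_nrmP/cS. Qed.

End ClosedSubspace.

Lemma closed_span_closed_subspace (A : cstarAlgType R) (S : set A) :
  closed_subspace (closed_span S).
Proof.
have lsub (c : R[i]) a b : linear_span S a -> linear_span S b ->
    linear_span S (c *: a + b).
  move=> [n [ca [ua [Sua ->]]]] [m [cb [ub [Sub ->]]]].
  exists (n + m)%N, (fun i : 'I_(n + m) => match fintype.split i with inl j => c * ca j | inr j => cb j end),
    (fun i : 'I_(n + m) => match fintype.split i with inl j => ua j | inr j => ub j end).
  split; first by move=> i; case: fintype.split.
  rewrite big_split_ord /= scaler_sumr; congr (_ + _); apply: eq_bigr => i _.
    by rewrite (unsplitK (inl i)) scalerA.
  by rewrite (unsplitK (inr i)).
split.
- exact: closed_closure.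
- apply: subset_closure; exists 0%N, (fun=> 0), (fun=> 0).
  by split; [case|rewrite big_ord0].
- move=> c a b /closure_nrmP aS /closure_nrmP bS; apply/closure_nrmP => e e0.
  set k := complex.Re `|c| + 1.
  have c0 : 0 <= complex.Re `|c| by rewrite -lecR RRe_real ?normr_ge0 // ger0_real ?normr_ge0.
  have k0 : 0 < k by rewrite ltr_wpDl.
  have [|a' Sa' aa'] := aS (e / 2 / k); first by rewrite !divr_gt0.
  have [|b' Sb' bb'] := bS (e / 2); first by rewrite divr_gt0.
  exists (c *: a' + b'); first exact: lsub.
  rewrite opprD addrACA -scalerBr; apply: le_lt_trans (nrmD _ _) _.
  rewrite [e]splitr ler_ltD// nrmZ.
  have : k * nrm (a - a') <= e / 2 by rewrite mulrC -ler_pdivlMr// ltW.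
  by apply: le_trans; rewrite ler_wpM2r ?nrm_ge0// /k lerDl.
Qed.

Lemma sub_closed_span (A : cstarAlgType R) (S : set A) : S `<=` closed_span S.
Proof.
move=> x Sx; apply: subset_closure; exists 1%N, (fun=> 1), (fun=> x).
by split => //; rewrite big_ord1 scale1r.
Qed.

(** The induction principle for closed spans: memberships are checked on
generators once the property defines a closed subspace. *)
Lemma closed_span_min (A : cstarAlgType R) (S T : set A) :
  closed_subspace T -> S `<=` T -> closed_span S `<=` T.
Proof.
move=> hT ST; rewrite /closed_span => x /closure_nrmP xS; apply: (csub_lim hT) => e /xS.
move=> [y [n [c [u [Su ->]]]] xy]; exists (\sum_(i < n) c i *: u i) => //.
by apply: (csub_sum hT) => i; apply: (csubZ hT); apply: ST.
Qed.

(** Stated for semilinear maps, so that it applies to the involution as well. *)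
Lemma closed_subspace_preim V W (f : V -> W) (k : R) (S : set W) :
  (forall a b, f (a - b) = f a - f b) ->
  (forall c a, exists c', f (c *: a) = c' *: f a) ->
  (forall a, nrm (f a) <= k * nrm a) ->
  closed_subspace S -> closed_subspace [set a | S (f a)].
Proof.
move=> fB fZ fk hS.
have f0 : f 0 = 0 by rewrite -(subrr 0) fB subrr.
split.
- move=> a /closure_nrmP aS /=; apply: (csub_lim hS) => e e0.
  have [|y Sy ay] := aS (e / (`|k| + 1)).
    by rewrite divr_gt0// ltr_wpDl.
  exists (f y) => //; rewrite -fB.
  apply: le_lt_trans (fk _) _.
  have : (`|k| + 1) * nrm (a - y) < e.
    by rewrite mulrC -ltr_pdivlMr// ltr_wpDl.
  by apply: le_lt_trans; rewrite ler_wpM2r ?nrm_ge0// ler_wpDr ?ler_norm.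
- by rewrite /= f0; case: hS.
- move=> c a b /= Sa Sb; rewrite -[b]opprK fB -[- b]add0r fB f0 sub0r opprK.
  have [c' ->] := fZ c a.
  by case: hS => _ _; exact.
Qed.

End RealNorm.

(** * Noncommutative ring normalisation *)
Section NcRing.
Context {A : pzRingType}.

#[global] Instance nc_ops :
  @Ncring.Ring_ops A 0 1 +%R *%R (fun x y => x - y) -%R (@eq A) := {}.

#[global] Instance nc_ring : Ncring.Ring (Ro := nc_ops).
Proof.
split; rewrite /Algebra_syntax.equality /=.
- exact: RelationClasses.eq_equivalence.
- by move=> ?? -> ?? ->.
- by move=> ?? -> ?? ->.
- by move=> ?? -> ?? ->.
- by move=> ?? ->.
- exact: add0r.
- exact: addrC.
- exact: addrA.
- exact: mul1r.
- exact: mulr1.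
- exact: mulrA.
- exact: mulrDl.
- by move=> x y z; exact: mulrDr.
- by [].
- exact: subrr.
Qed.
End NcRing.

(** Identities between noncommutative polynomials; the goal is first put in the
setoid form on which the normalisation procedure works. *)
Ltac ncring :=
  lazymatch goal with |- @eq ?T ?x ?y =>
    let r := constr:(T : pzRingType) in
    change (@Algebra_syntax.equality (GRing.PzRing.sort r) (@Ncring.eq_notation _ _ _ _ _ _ _ _ (@nc_ops r)) x y);
    Ncring_tac.non_commutative_ring
  end.

(** The two unit laws are arguments of the type, so that the ring structure on it
can be inferred. *)
Definition unital (R : realType) (A : cstarAlgType R) (e : A)
  (e1 : left_id e cmul) (e2 : right_id e cmul) : Type := A.

Section UnitalDef.
Context (R : realType) (A : cstarAlgType R) (e : A)
  (e1 : left_id e cmul) (e2 : right_id e cmul).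
HB.instance Definition _ := CStarAlgebra.copy (unital e1 e2) A.
HB.instance Definition _ := GRing.Zmodule_isPzRing.Build (unital e1 e2)
  (@cmulA R A) e1 e2 (@cmulDl R A) (@cmulDr R A).
End UnitalDef.

(** * Positivity in unital C*-algebras *)
Section Positivity.
Local Open Scope complex_scope.
Context {R : realType} {A : cstarAlgType R} {e : A}
  {e1 : left_id e cmul} {e2 : right_id e cmul}.
Local Notation U := (unital e1 e2).
Implicit Types x y z h k p q w : U.

Lemma nrmM x y : nrm (x * y) <= nrm x * nrm y.
Proof. by rewrite -lecR rmorphM /= -!normE; exact: cnormM. Qed.

Lemma scaleAl (c : R[i]) x y : c *: x * y = c *: (x * y).
Proof. exact: cmulZl. Qed.

Lemma scaleAr (c : R[i]) x y : x * (c *: y) = c *: (x * y).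
Proof. exact: cmulZr. Qed.

Lemma starMr x y : star (x * y) = star y * star x :> U.
Proof. exact: starM. Qed.

Lemma star0 : star 0 = 0 :> U.
Proof. by apply: (@addrI U (star 0)); rewrite -[LHS]starD !addr0. Qed.

Lemma starN x : star (- x) = - star x :> U.
Proof. by apply/eqP; rewrite -subr_eq0 opprK -[X in X == _]starD addNr star0. Qed.

Lemma starB x y : star (x - y) = star x - star y :> U.
Proof. by rewrite [LHS]starD starN. Qed.

Lemma star1 : star (1 : U) = 1 :> U.
Proof. by rewrite -[RHS](starK (1 : U)) -[in RHS](mulr1 (star (1 : U) : U)) starMr starK mulr1. Qed.

Lemma starZr (t : R) x : star (t%:C *: x) = t%:C *: star x :> U.
Proof. by rewrite [LHS]starZ (CrealP _)// complex_real. Qed.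

Lemma nrm_star_mul x : nrm (star x * x) = nrm x ^+ 2.
Proof. by apply: complexI; rewrite rmorphXn /= -!normE; exact: cstar_identity. Qed.

Lemma nrm_sqr h : star h = h -> nrm (h * h) = nrm h ^+ 2.
Proof. by move=> hh; rewrite -nrm_star_mul hh. Qed.

Lemma nrm_star x : nrm (star x : U) = nrm x.
Proof.
have le z : nrm z <= nrm (star z : U).
  have := nrmM (star z) z; rewrite nrm_star_mul expr2.
  have := nrm_ge0 z; rewrite le_eqVlt => /orP[/eqP <- _|z0]; first exact: nrm_ge0.
  by rewrite ler_pM2r.
by apply/eqP; rewrite eq_le le andbT -{2}[x]starK; exact: le.
Qed.

Lemma nrm1 : nrm (1 : U) <= 1.
Proof.
have := nrm_star_mul 1; rewrite star1 mulr1 => h1.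
move: h1; set n := nrm _ => h1; nra.
Qed.

(** The fixed point equation [w = (z + w * w) / 2] says that [1 - w] is a square
root of [1 - z]. The iteration is dominated by the same iteration on the real
line for [z = 1], which increases to [1]. *)
Fixpoint sqrt_iter z n : U :=
  if n is n'.+1 then (2^-1)%:C *: (z + sqrt_iter z n' * sqrt_iter z n') else 0.

Fixpoint sqrt_bound n : R :=
  if n is n'.+1 then (1 + sqrt_bound n' * sqrt_bound n') / 2 else 0.

Lemma sqrt_bound_ge0 n : 0 <= sqrt_bound n <= 1.
Proof. by elim: n => [|n ih] /=; [lra|nra]. Qed.

(** The defect [d = 1 - t] evolves by [d - d^2 / 2]. *)
Lemma sqrt_bound_lim n : 1 - sqrt_bound n <= 2 / n.+2%:R.
Proof.
elim: n => [|n ih] /=; first by lra.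
have /andP[t0 t1] := sqrt_bound_ge0 n.
have -> : n.+3%:R = n.+2%:R + 1 :> R by rewrite -addn1 natrD.
have D2 : 2 <= n.+2%:R :> R by rewrite ler_nat.
set D : R := n.+2%:R in ih D2 *; set t := sqrt_bound n in ih t0 t1 *.
have cD : 2 / D * D = 2 by rewrite divfK//; apply/eqP; lra.
have c0 : 0 <= 2 / D by rewrite divr_ge0//; lra.
set c := 2 / D in ih cD c0 *.
have c1 : c <= 1 by nra.
rewrite ler_pdivlMr; last by lra.
have : 1 - (1 + t * t) / 2 <= c - c * c / 2 by nra.
nra.
Qed.

Lemma sqrt_bound_small (eps : R) : 0 < eps -> exists n, 1 - sqrt_bound n < eps.
Proof.
move=> eps0; exists (Num.truncn (2 / eps)).
apply: le_lt_trans (sqrt_bound_lim _) _.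
rewrite ltr_pdivrMr ?ltr0n// mulrC -ltr_pdivrMr//.
apply: lt_le_trans (truncnS_gt _) _; by rewrite ler_nat.
Qed.

Lemma eq0_of_sqrt_bound x (k : R) : (forall n, nrm x <= k * (1 - sqrt_bound n)) -> x = 0.
Proof.
move=> xk; apply: nrm_eq0; apply/eqP; rewrite eq_le nrm_ge0 andbT.
apply/ler_addgt0Pr => eps eps0; rewrite add0r.
have k0 : 0 < `|k| + 1 by rewrite ltr_wpDl.
have [n] := sqrt_bound_small (divr_gt0 eps0 k0); rewrite ltr_pdivlMr// => nk.
have /andP[_ b0] := sqrt_bound_ge0 n.
apply: le_trans (xk n) _; apply: le_trans (ltW nk).
rewrite mulrC ler_wpM2l ?subr_ge0//.
by apply: le_trans (ler_norm _) _; rewrite lerDl.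
Qed.

Section SqrtIter.
Variables (z : U) (zz : star z = z) (z1 : nrm z <= 1).
Local Notation w := (sqrt_iter z).
Local Notation t := sqrt_bound.

Lemma star_sqrt_iter n : star (w n : U) = w n.
Proof.
elim: n => [|n ih] /=; first exact: star0.
by rewrite starZr [in LHS]starD starMr ih zz.
Qed.

Lemma comm_sqrt_iter y n : GRing.comm y z -> GRing.comm y (w n).
Proof.
move=> yz; elim: n => [|n ih] /=; first exact: commr0.
rewrite /GRing.comm scaleAl scaleAr; congr (_ *: _).
by apply: commrD => //; apply: commrM.
Qed.

Lemma nrm_sqrt_iter n : nrm (w n) <= t n.
Proof.
have half : `|2^-1 : R| = 2^-1 by rewrite ger0_norm// invr_ge0.
elim: n => [|n ih] /=; first by rewrite nrm0.
rewrite nrmZr half mulrC ler_wpM2r ?invr_ge0//.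
apply: le_trans (nrmD _ _) _; rewrite lerD//.
by apply: le_trans (nrmM _ _) _; rewrite ler_pM ?nrm_ge0.
Qed.

Lemma sqrt_iter_step n : nrm (w n.+1 - w n) <= t n.+1 - t n.
Proof.
have half : `|2^-1 : R| = 2^-1 by rewrite ger0_norm// invr_ge0.
elim: n => [|n ih].
  rewrite /= subr0 mulr0 addr0 nrmZr half. by move: z1; set r := nrm _; lra.
have c : GRing.comm (w n) (w n.+1).
  by apply: comm_sqrt_iter; apply/commr_sym/comm_sqrt_iter.
have -> : w n.+2 - w n.+1 = (2^-1)%:C *: ((w n.+1 - w n) * (w n.+1 + w n)).
  have E i : w i.+1 = (2^-1)%:C *: (z + w i * w i) by [].
  rewrite [w n.+2]E [in X in _ - X = _]E -scalerBr; congr (_ *: _).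
  rewrite mulrDr !mulrBl c.
  by ncring.
rewrite nrmZr half.
have -> : t n.+2 - t n.+1 = 2^-1 * ((t n.+1 - t n) * (t n.+1 + t n)).
  have E i : t i.+1 = (1 + t i * t i) / 2 by [].
  rewrite E {3}(E n); set a := t n.+1; set b := t n.
  by field.
rewrite ler_wpM2l ?invr_ge0//; apply: le_trans (nrmM _ _) _.
rewrite ler_pM ?nrm_ge0//; apply: le_trans (nrmD _ _) _.
by rewrite lerD ?nrm_sqrt_iter.
Qed.

Lemma sqrt_iter_cauchy n m : (n <= m)%N -> nrm (w m - w n) <= 1 - t n.
Proof.
move=> nm; suff : nrm (w m - w n) <= t m - t n.
  by move/le_trans; apply; rewrite lerB//; case/andP: (sqrt_bound_ge0 m).
rewrite -(subnK nm); elim: (m - n)%N => [|j ih]; first by rewrite add0n !subrr nrm0.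
rewrite addSn; set i := (j + n)%N in ih *.
rewrite -(subrKA (w i)); apply: le_trans (nrmD _ _) _.
rewrite -[leRHS](subrKA (t i)). by rewrite lerD ?sqrt_iter_step.
Qed.

Lemma sqrt_compl_ex : exists w : U, [/\ star w = w, nrm w <= 1,
  (1 - w) * (1 - w) = 1 - z & forall y, GRing.comm y z -> GRing.comm y w].
Proof.
have [l lw] := @nrm_complete R U w _ sqrt_bound_small sqrt_iter_cauchy.
exists l.
have l1 : nrm l <= 1.
  rewrite -(subrK (w 0%N) l); apply: le_trans (nrmD _ _) _.
  by have := lw 0%N; rewrite /= nrm0 addr0 !subr0. 
split=> //.
- apply/eqP; rewrite -subr_eq0; apply/eqP; apply: (@eq0_of_sqrt_bound _ 2) => n.
  have -> : star l - l = star (l - w n) - (l - w n) :> U.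
    by rewrite starB star_sqrt_iter opprB addrA subrK.
  apply: le_trans (nrmB _ _) _; rewrite nrm_star.
  by have := lw n; lra.
- apply/eqP; rewrite -subr_eq0; apply/eqP; apply: (@eq0_of_sqrt_bound _ 4) => n.
  set r := w n.
  have rE : z = 2%:C *: w n.+1 - r * r.
    rewrite /= scalerA -rmorphM /= divff ?scale1r ?addrK//.
  have -> : (1 - l) * (1 - l) - (1 - z) =
      (l - r) * l + r * (l - r) - 2%:C *: (l - w n.+1).
    rewrite scalerBr {1}rE.
    have -> : 2%:C *: l = l + l by rewrite (_ : 2%:C = 1 + 1) ?scalerDl ?scale1r// -rmorphD.
    ncring.
  have sub : 1 - t n.+1 <= 1 - t n.
    rewrite lerB//; have := sqrt_iter_step n; have := nrm_ge0 (w n.+1 - w n).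
    by lra.
  have r1 : nrm r <= 1 by apply: le_trans (nrm_sqrt_iter n) _; case/andP: (sqrt_bound_ge0 n).
  apply: le_trans (nrmB _ _) _; rewrite nrmZr (ger0_norm (ler0n _ 2)).
  have lrn := lw n; have lsn := lw n.+1; rewrite -/r in lrn.
  have : nrm ((l - r) * l + r * (l - r)) <= 2 * (1 - t n).
    apply: le_trans (nrmD _ _) _; rewrite mulr_natl mulr2n lerD//.
      apply: le_trans (nrmM _ _) _; rewrite -[leRHS]mulr1 ler_pM ?nrm_ge0//.
    apply: le_trans (nrmM _ _) _; rewrite -[leRHS]mul1r ler_pM ?nrm_ge0//.
  by lra.
- move=> y yz; apply/eqP; rewrite -subr_eq0; apply/eqP.
  apply: (@eq0_of_sqrt_bound _ (2 * nrm y)) => n.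
  have -> : y * l - l * y = y * (l - w n) - (l - w n) * y.
    by rewrite mulrBr mulrBl (comm_sqrt_iter n yz); ncring.
  have ln := lw n.
  have := nrmM y (l - w n); have := nrmM (l - w n) y.
  have := nrmB (y * (l - w n)) ((l - w n) * y).
  have y0 := nrm_ge0 y; nra.
Qed.

End SqrtIter.

(** The positive cone. For self-adjoint [p] the inequality [|t - p| <= t] says that
the spectrum lies in the interval from [0] to [2 t]; in this form stability under
sums is the triangle inequality. *)
Definition posc p := star p = p /\ exists2 t : R, 0 < t & nrm (t%:C *: (1 : U) - p) <= t.

Lemma posc_compl p : star p = p -> nrm p <= 1 -> posc (1 - p).
Proof.
move=> pp p1; split; first by rewrite starB star1 pp.
by exists 1 => //; rewrite scale1r subKr.
Qed.

Lemma posc0 : posc 0.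
Proof. by split; [exact: star0|exists 1 => //; rewrite scale1r subr0 nrm1]. Qed.

Lemma posc1 : posc 1.
Proof. by rewrite -[1]subr0; apply: posc_compl; rewrite ?star0 ?nrm0. Qed.

Lemma poscD p q : posc p -> posc q -> posc (p + q).
Proof.
move=> [pp [t t0 pt]] [qq [s s0 qs]]; split; first by rewrite [LHS]starD pp qq.
exists (t + s); first exact: addr_gt0.
rewrite rmorphD /= scalerDl opprD addrACA.
by apply: le_trans (nrmD _ _) _; exact: lerD.
Qed.

Lemma poscZ (s : R) p : 0 <= s -> posc p -> posc (s%:C *: p).
Proof.
rewrite le_eqVlt => /orP[/eqP <- _|s0 [pp [t t0 pt]]].
  by rewrite scale0r; exact: posc0.
split; first by rewrite starZr pp.
exists (s * t); first exact: mulr_gt0.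
by rewrite rmorphM /= -scalerA -scalerBr nrmZr gtr0_norm// ler_pM2l.
Qed.

Lemma poscMn p n : posc p -> posc (p *+ n).
Proof.
move=> pp; elim: n => [|n ih]; first exact: posc0.
by rewrite mulrS; exact: poscD.
Qed.

Lemma posc_sqrt p : posc p -> exists s : U, [/\ star s = s, posc s, s * s = p &
  forall y, GRing.comm y p -> GRing.comm y s].
Proof.
move=> [pp [t t0 pt]].
pose z := 1 - (t^-1)%:C *: p.
have zz : star z = z by rewrite starB starZr star1 pp.
have tt : t%:C *: z = t%:C *: (1 : U) - p.
  by rewrite scalerBr scalerA -rmorphM /= mulfV ?gt_eqF// scale1r.
have z1 : nrm z <= 1.
  by rewrite -(ler_pM2l t0) mulr1 -{1}(gtr0_norm t0) -nrmZr tt.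
have [w [ww w1 wz wc]] := sqrt_compl_ex zz z1.
have st0 : 0 < Num.sqrt t by rewrite sqrtr_gt0.
exists ((Num.sqrt t)%:C *: (1 - w)); split.
- by rewrite starZr starB star1 ww.
- by apply: poscZ; [exact: ltW|exact: posc_compl].
- rewrite scaleAl scaleAr scalerA -rmorphM /= -expr2 sqr_sqrtr ?(ltW t0)//.
  by rewrite wz subKr scalerA -rmorphM /= mulfV ?gt_eqF// scale1r.
- move=> y yp; rewrite /GRing.comm scaleAl scaleAr; congr (_ *: _).
  apply: commrB; first exact: commr1.
  apply: wc; apply: commrB; first exact: commr1.
  by rewrite /GRing.comm scaleAl scaleAr yp.
Qed.

(** For [u = h + i k] one has [star u * u = h^2 + k^2], and [h] is the real part
of [u]. *)
Lemma nrm_sqr_le h k : star h = h -> star k = k -> GRing.comm h k ->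
  nrm h ^+ 2 <= nrm (h * h + k * k).
Proof.
move=> hh kk hk; pose u : U := h + 'i *: k.
have ui : star u = h - 'i *: k.
  rewrite [LHS]starD hh [star ('i *: k)]starZ kk; congr (_ + _).
  by rewrite -scaleNr; congr (_ *: _); apply/eqP; rewrite eq_complex /= oppr0 !eqxx.
have uu : star u * u = h * h + k * k.
  rewrite ui /u mulrDr !mulrBl !scaleAl !scaleAr scalerA hk.
  rewrite (_ : 'i * 'i = -1 :> R[i]) ?scaleN1r; last by rewrite -expr2 sqr_i.
  by ncring.
have hE : h = (2^-1)%:C *: (star u + u).
  rewrite ui /u addrCA subrK -[h + h]mulr2n -[h *+ 2]scaler_nat scalerA.
  have -> : (2^-1)%:C * 2%:R = 1 :> R[i].
    rewrite (_ : 2%:R = 2%:C) -?rmorphM /= ?mulVf//.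
    by rewrite [RHS]rmorphD.
  by rewrite scale1r.
rewrite -uu nrm_star_mul ler_sqr ?nnegrE ?nrm_ge0// hE nrmZr.
have := nrmD (star u) u; rewrite nrm_star => n2.
have half : `|2^-1 : R| = 2^-1 by rewrite ger0_norm// invr_ge0.
rewrite half; move: n2; set r1 := nrm _; set r2 := nrm _; lra.
Qed.

(** Scale so that [h] has norm at most [1]. Then [1 - h^2] is a square [k^2] with [k]
commuting with [h], and [nrm_sqr_le] bounds [k] by [h^2 + k^2 = 1]; hence
[|1 - h^2| <= 1]. *)
Lemma posc_sqr h : star h = h -> posc (h * h).
Proof.
move=> hh; split; first by rewrite starMr hh.
pose t := nrm h ^+ 2 + 1.
have t0 : 0 < t by rewrite ltr_wpDl ?sqr_ge0.
exists t => //.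
pose h' := ((Num.sqrt t)^-1)%:C *: h.
have hh' : star h' = h' by rewrite starZr hh.
have h'E : h' * h' = (t^-1)%:C *: (h * h).
  rewrite scaleAl scaleAr scalerA -rmorphM /= -invfM -expr2 sqr_sqrtr//.
  exact: ltW.
have z1 : nrm (h' * h') <= 1.
  rewrite h'E nrmZr gtr0_norm ?invr_gt0// ler_pdivrMl// mulr1 nrm_sqr//.
  by rewrite lerDl.
have zz : star (h' * h') = h' * h' by rewrite starMr hh'.
have [w [ww w1 wz wc]] := sqrt_compl_ex zz z1.
have k2 : nrm (1 - w) ^+ 2 <= nrm ((1 - w) * (1 - w) + h' * h').
  apply: nrm_sqr_le => //; first by rewrite starB star1 ww.
  apply/commr_sym/commrB; first exact: commr1.
  by apply: wc; rewrite /GRing.comm mulrA.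
have : nrm ((1 - w) * (1 - w)) <= 1.
  rewrite nrm_sqr; last by rewrite starB star1 ww.
  by apply: le_trans k2 _; rewrite wz subrK nrm1.
rewrite wz h'E -(ler_pM2l t0) mulr1 -{1}(gtr0_norm t0) -nrmZr scalerBr scalerA.
by rewrite -rmorphM /= mulfV ?gt_eqF// scale1r.
Qed.

Lemma poscM p q : posc p -> posc q -> GRing.comm p q -> posc (p * q).
Proof.
move=> /posc_sqrt[s [ss _ <- sc]] /posc_sqrt[r [rr _ rq rc]] pq.
have sq : GRing.comm q s by apply: sc; exact: commr_sym.
have sr : GRing.comm s r by apply: rc; exact: commr_sym.
have -> : s * s * q = (s * r) * (s * r).
  by rewrite -rq -!mulrA; congr (_ * _); rewrite !mulrA sr.
by apply: posc_sqr; rewrite starMr ss rr sr.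
Qed.

Lemma posc_exp p n : posc p -> posc (p ^+ n).
Proof.
move=> pp; elim: n => [|n ih]; first exact: posc1.
by rewrite exprS; apply: poscM => //; exact: commrX.
Qed.

(** Write [p = r^2] and [1 - p = w^2] with [r] and [w] commuting; then [nrm_sqr_le]
bounds [r] by [r^2 + w^2 = 1]. *)
Lemma posc_le1 p : posc p -> posc (1 - p) -> nrm p <= 1.
Proof.
move=> /posc_sqrt[r [rr _ rp _]] /posc_sqrt[w [ww _ wp wc]].
rewrite -rp nrm_sqr//; have : nrm r ^+ 2 <= nrm (r * r + w * w).
  apply: nrm_sqr_le => //; apply: wc.
  by apply: commrB; [exact: commr1|rewrite -rp; apply: commrM].
by move=> /le_trans; apply; rewrite wp rp subrKC nrm1.
Qed.

(** After division by some [s] larger than [|p + q|], the element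
[1 - p = (1 - (p + q)) + q] is a sum of positive elements. *)
Lemma posc_mono p q : posc p -> posc q -> nrm p <= nrm (p + q).
Proof.
move=> pp qq; apply/ler_addgt0Pr => eps eps0.
set s := _ + eps; have s0 : 0 < s by rewrite ltr_wpDl ?nrm_ge0.
have sV : 0 <= s^-1 by rewrite invr_ge0 ltW.
have : nrm ((s^-1)%:C *: p) <= 1.
  apply: posc_le1; first exact: poscZ.
  have -> : 1 - s^-1%:C *: p = (1 - s^-1%:C *: (p + q)) + s^-1%:C *: q.
    by rewrite scalerDr opprD addrA subrK.
  apply: poscD; last exact: poscZ.
  apply: posc_compl; first by have [] := poscZ sV (poscD pp qq).
  by rewrite nrmZr ger0_norm// ler_pdivrMl// mulr1 /s lerDl ltW.
by rewrite nrmZr ger0_norm// ler_pdivrMl// mulr1.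
Qed.

Lemma nrmX_le1 x n : nrm x <= 1 -> nrm (x ^+ n) <= 1.
Proof.
move=> x1; elim: n => [|n ih]; first exact: nrm1.
rewrite exprS; apply: le_trans (nrmM _ _) _.
by rewrite -[leRHS]mulr1 ler_pM ?nrm_ge0.
Qed.

(** The powers of [1 - y * star y] stay bounded, whereas for [d = - (star y * y)]
the elements [(1 + d)^n d] grow at least like [n d^2]; the relation
[(1 - y * star y)^n y = y (1 + d)^n] forces [d = 0]. *)
Lemma posc_opp_le1 y : nrm y <= 1 -> posc (y * star y) -> posc (- (star y * y)) -> y = 0.
Proof.
move=> y1 qp; set d := - _ => dp.
have sy : star d = d by case: dp.
pose B n : U := (1 + d) ^+ n * d.
have dB n : GRing.comm d (B n).
  by apply: commrM => //; apply: commrX; apply: commrD => //; exact: commr1.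
have BE n : B n = - (star y * ((1 - y * star y) ^+ n * y)).
  have -> : (1 - y * star y) ^+ n * y = y * (1 + d) ^+ n.
    elim: n => [|n ih]; first by rewrite !expr0 mul1r mulr1.
    by rewrite exprS -mulrA ih exprS !mulrA; congr (_ * _); rewrite /d; ncring.
  rewrite mulrA -mulNr -/d /B; apply/commr_sym/commrX.
  by apply: commrD => //; exact: commr1.
have q1 : nrm (y * star y) <= 1.
  by apply: le_trans (nrmM _ _) _; rewrite nrm_star -[leRHS]mulr1 ler_pM ?nrm_ge0.
have B1 n : nrm (B n) <= 1.
  rewrite BE nrmN; apply: le_trans (nrmM _ _) _; rewrite nrm_star -[leRHS]mulr1.
  rewrite ler_pM ?nrm_ge0//; apply: le_trans (nrmM _ _) _; rewrite -[leRHS]mulr1.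
  rewrite ler_pM ?nrm_ge0//; apply: nrmX_le1.
  apply: posc_le1; last by rewrite subKr.
  by apply: posc_compl => //; case: qp.
have dd : posc (d * d) by apply: poscM.
have Ep n : posc (B n - d - (d * d) *+ n).
  elim: n => [|n ih]; first by rewrite /B expr0 mul1r subrr sub0r oppr0; exact: posc0.
  have -> : B n.+1 - d - (d * d) *+ n.+1 =
      (B n - d - (d * d) *+ n) + d * ((B n - d - (d * d) *+ n) + (d * d) *+ n).
    have -> : B n.+1 = (1 + d) * B n by rewrite /B exprS mulrA.
    by rewrite subrK mulrS; ncring.
  apply: poscD => //; apply: poscM => //.
    by apply: poscD => //; apply: poscMn.
  rewrite subrK; apply: commrB => //.
have dn n : nrm (d * d) *+ n <= 1.
  apply: le_trans (B1 n).
  rewrite -nrmMn.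
  rewrite (_ : B n = (d * d) *+ n + ((B n - d - (d * d) *+ n) + d)).
    by apply: posc_mono; [exact: poscMn|exact: poscD].
  by ncring.
have d0 : nrm (d * d) = 0.
  apply/eqP; rewrite eq_le nrm_ge0 andbT leNgt; apply/negP => dpos.
  have := dn (Num.truncn (nrm (d * d))^-1).+1; apply/negP; rewrite -ltNge.
  rewrite -mulr_natl -ltr_pdivrMr// div1r; exact: truncnS_gt.
apply: nrm_eq0; apply/eqP; rewrite -sqrf_eq0 -nrm_star_mul -nrmN -/d -sqrf_eq0.
by rewrite -nrm_sqr// d0.
Qed.

Lemma posc_opp y : posc (y * star y) -> posc (- (star y * y)) -> y = 0.
Proof.
move=> p1 p2; have n0 : 0 < nrm y + 1 by rewrite ltr_wpDl ?nrm_ge0.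
have nV : 0 <= (nrm y + 1)^-1 by rewrite invr_ge0 ltW.
pose y' : U := ((nrm y + 1)^-1)%:C *: y.
have y'0 : y' = 0.
  apply: posc_opp_le1.
  - by rewrite nrmZr ger0_norm// ler_pdivrMl// mulr1 lerDl.
  - by rewrite starZr scaleAl scaleAr; apply: poscZ => //; apply: poscZ.
  - rewrite starZr scaleAl scaleAr -!scalerN.
    by apply: poscZ => //; apply: poscZ.
have -> : y = (nrm y + 1)%:C *: y'.
  by rewrite scalerA -rmorphM /= mulfV ?gt_eqF// scale1r.
by rewrite y'0 scaler0.
Qed.

(** With [h = star x * x], [a = |h|] and [m = a - h], twice the negative part of
[h], the element [y = x m] satisfies [star y * y = - a m^2], whereas
[y * star y + star y * y] is always positive, being half of a sum of two squares of
self-adjoint elements. By [posc_opp], [y = 0], whence [m = 0] and [h = a]. *)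
Lemma posc_star_mul x : posc (star x * x).
Proof.
set h := star x * x.
have hh : star h = h by rewrite starMr starK.
have [a [aa ap a2 ac]] := posc_sqrt (posc_sqr hh).
have ha : GRing.comm h a by apply: ac; apply: commrM.
pose m := a - h.
have mm : star m = m by rewrite starB aa hh.
have am : GRing.comm a m by apply: commrB => //; exact: commr_sym.
have hm : GRing.comm h m by apply: commrB.
have hmE : h * m = - (a * m) by rewrite /m !mulrBr a2 ha; ncring.
pose d := a * (m * m).
have dp : posc d.
  by apply: poscM => //; [exact: posc_sqr|apply: commrM].
pose y := x * m.
have yy : star y * y = - d.
  by rewrite /d starMr mm -mulrA [star x * _]mulrA -/h hmE mulrN !mulrA -am.
have yyp : posc (y * star y).
  pose c1 := y + star y; pose c2 : U := 'i *: (y - star y).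
  have c1p : posc (c1 * c1) by apply: posc_sqr; rewrite [LHS]starD starK addrC.
  have c2p : posc (c2 * c2).
    apply: posc_sqr; rewrite [LHS]starZ starB starK.
    rewrite -[RHS]opprK -scalerN opprB -scaleNr; congr (_ *: _).
    by apply/eqP; rewrite eq_complex /= oppr0 !eqxx.
  have -> : y * star y = (2^-1)%:C *: (c1 * c1 + c2 * c2 + (d + d)).
    rewrite /c2 scaleAl scaleAr scalerA (_ : 'i * 'i = -1 :> R[i]) ?scaleN1r; last first.
      by rewrite -expr2 sqr_i.
    have -> : c1 * c1 - (y - star y) * (y - star y) + (d + d) = y * star y + y * star y.
      have dE : d = - (star y * y) by rewrite yy opprK.
      by rewrite dE /c1; ncring.
    rewrite -[y * star y + _]mulr2n -[y * star y *+ 2]scaler_nat scalerA (_ : (2^-1)%:C * 2%:R = 1 :> R[i]) ?scale1r//.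
    by rewrite (_ : 2%:R = 2%:C) -?rmorphM /= ?mulVf// [RHS]rmorphD.
  by apply: poscZ; rewrite ?invr_ge0//; apply: poscD; apply: poscD.
have y0 : y = 0 by apply: posc_opp => //; rewrite yy opprK.
have d0 : d = 0 by apply/eqP; rewrite -oppr_eq0 -yy y0 mulr0.
have m2 : m * m = a * m + a * m by rewrite {1}/m mulrBl hmE opprK.
have m3 : m * m * m = 0 by rewrite m2 mulrDl -mulrA -/d d0 addr0.
have m0 : m = 0.
  apply: nrm_eq0; apply/eqP; rewrite -sqrf_eq0 -nrm_sqr// -sqrf_eq0 -nrm_sqr.
    by rewrite mulrA m3 mul0r nrm0.
  by rewrite starMr mm.
by have -> : h = a by apply/esym/eqP; rewrite -subr_eq0; apply/eqP.
Qed.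

(** The analogue of [t (1 - t)^n <= 1 / n] on the unit interval: with [q = 1 - p] the
terms [p q^k] decrease, and those with [k < n] add up to [1 - q^n]. *)
Lemma nrm_mul_compl_exp p n : posc p -> nrm p <= 1 -> nrm ((p * (1 - p) ^+ n) *+ n) <= 1.
Proof.
move=> pp p1; set q := 1 - p.
have qp : posc q by apply: posc_compl => //; case: pp.
have pq : GRing.comm p q by apply: commrB => //; exact: commr1.
have mp i : posc (p * q ^+ i).
  by apply: poscM => //; [exact: posc_exp|exact: commrX].
apply: posc_le1; first exact: poscMn.
suff Q i : posc (1 - (p * q ^+ i) *+ i - q ^+ i).
  by rewrite -[X in posc X](subrK (q ^+ n)); apply: poscD => //; exact: posc_exp.
elim: i => [|i ih]; first by rewrite mulr0n subr0 subrr; exact: posc0.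
have -> : 1 - (p * q ^+ i.+1) *+ i.+1 - q ^+ i.+1 =
   (1 - (p * q ^+ i) *+ i - q ^+ i) + (p * (p * q ^+ i)) *+ i.+1.
  have -> : q ^+ i.+1 = q ^+ i - p * q ^+ i by rewrite exprS mulrBl mul1r.
  rewrite mulrBr mulrnBl !mulrS.
  by ncring.
by apply: poscD => //; apply: poscMn; apply: poscM => //; apply: commrM => //; exact: commrX.
Qed.

Lemma closed_subspace_mul (S : set U) x y :
  closed_subspace S -> closed_subspace [set a | S (x * a * y)].
Proof.
move=> hS; apply: (closed_subspace_preim (f := fun a : U => x * a * y) _ _ _ hS).
- by move=> a b; rewrite mulrBr mulrBl.
- by move=> c a; exists c; rewrite scaleAr scaleAl.
- move=> a; apply: le_trans (nrmM _ _) _; rewrite [leRHS](_ : _ = nrm x * nrm a * nrm y).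
    by rewrite ler_wpM2r ?nrm_ge0 ?nrmM.
  by rewrite mulrAC.
Qed.

Lemma closed_subspace_star (S : set U) :
  closed_subspace S -> closed_subspace [set a : U | S (star a)].
Proof.
move=> hS; apply: (@closed_subspace_preim R U U (fun a : U => star a) 1 S _ _ _ hS).
- exact: starB.
- by move=> c a; eexists; exact: starZ.
- by move=> a; rewrite mul1r nrm_star.
Qed.

(** The elements [1 - q^n] act on [x] as an approximate unit taken from [S]. *)
Lemma hereditary_of_corner (S : set U) x y : closed_subspace S ->
  (forall a b, S a -> S b -> S (a * b)) ->
  (forall a f b, S a -> S b -> S (a * f * b)) ->
  S (star x * x + star y * y) -> S (star x * x).
Proof.
move=> hS SM Sc; set b := _ + _ => Sb.
have bp : posc b by apply: poscD; exact: posc_star_mul.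
have n0 : 0 < nrm b + 1 by rewrite ltr_wpDl ?nrm_ge0.
pose c := (nrm b + 1)^-1.
have c0 : 0 < c by rewrite invr_gt0.
pose p : U := c%:C *: b; pose q := 1 - p.
have Sp : S p by exact: csubZ.
have pp : posc p by apply: poscZ => //; exact: ltW.
have p1 : nrm p <= 1.
  by rewrite nrmZr gtr0_norm// /c ler_pdivrMl// mulr1 lerDl.
have qp : posc q by apply: posc_compl => //; case: pp.
have q1 : nrm q <= 1 by apply: posc_le1 => //; rewrite subKr.
have qq n : star (q ^+ n) = q ^+ n by case: (posc_exp n qp).
have pq n : GRing.comm p (q ^+ n) by apply: commrX; apply: commrB => //; exact: commr1.
have Se n : S (1 - q ^+ n).
  elim: n => [|n ih]; first by rewrite subrr; case: hS.
  rewrite exprSr {2}/q mulrBr mulr1 opprB addrA.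
  have -> : 1 + q ^+ n * p - q ^+ n = (1 - q ^+ n) + (p - (1 - q ^+ n) * p) by ncring.
  by apply: csubD => //; apply: csubB => //; exact: SM.
have xq n : nrm (x * q ^+ n) ^+ 2 *+ n <= c^-1.
  have E (z : U) : star (z * q ^+ n) * (z * q ^+ n) = q ^+ n * (star z * z) * q ^+ n.
    by rewrite starMr qq !mulrA.
  have le1 : nrm (x * q ^+ n) ^+ 2 <= nrm (q ^+ n * b * q ^+ n).
    rewrite -nrm_star_mul /b mulrDr mulrDl -!E.
    by apply: posc_mono; exact: posc_star_mul.
  have bE : q ^+ n * b * q ^+ n = c^-1%:C *: (q ^+ n * (p * q ^+ n)).
    by rewrite /p !(scaleAl, scaleAr) scalerA -rmorphM /= mulVf ?gt_eqF// scale1r mulrA.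
  apply: le_trans (_ : c^-1 * nrm ((p * q ^+ n) *+ n) <= _); last first.
    by rewrite -[leRHS]mulr1 ler_pM2l ?invr_gt0//; exact: nrm_mul_compl_exp.
  rewrite nrmMn mulrnAr ler_wMn2r//; apply: le_trans le1 _.
  rewrite bE nrmZr gtr0_norm ?invr_gt0// ler_pM2l ?invr_gt0//.
  apply: le_trans (nrmM _ _) _; rewrite -[leRHS]mul1r ler_wpM2r ?nrm_ge0//.
  exact: nrmX_le1.
set a := star x * x.
apply: (csub_lim hS) => eps eps0.
(* compressing [a] by [1 - f] changes it by at most [3 |x| |x f|] *)
pose K := 3 * nrm x + 1.
have K0 : 0 < K by rewrite ltr_wpDl// mulr_ge0// nrm_ge0.
pose del := (eps / K) ^+ 2.
have del0 : 0 < del by rewrite exprn_gt0// divr_gt0.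
pose n := (Num.truncn (c^-1 / del)).+1.
have small : nrm (x * q ^+ n) < eps / K.
  rewrite -ltr_sqr ?nnegrE ?nrm_ge0// ?ltW ?divr_gt0// -/del.
  have n1 : c^-1 / del < n%:R by exact: truncnS_gt.
  have nn : 0 < n%:R :> R by rewrite ltr0n.
  have : nrm (x * q ^+ n) ^+ 2 < del.
    rewrite -(ltr_pM2r nn) mulr_natr; apply: le_lt_trans (xq n) _.
    by rewrite mulrC -ltr_pdivrMr.
  by [].
exists ((1 - q ^+ n) * a * (1 - q ^+ n)); first exact: Sc.
set f := q ^+ n in small *.
have -> : a - (1 - f) * a * (1 - f) = star (x * f) * x + (1 - f) * (star x * (x * f)).
  by rewrite starMr qq /a; ncring.
have f1 : nrm f <= 1 by exact: nrmX_le1.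
have f2 : nrm (1 - f) <= 2.
  by apply: le_trans (nrmB _ _) _; rewrite -[2]/(1 + 1) lerD ?nrm1.
have l1 : nrm (star (x * f) * x) <= nrm x * nrm (x * f).
  by apply: le_trans (nrmM _ _) _; rewrite nrm_star mulrC.
have l2 : nrm ((1 - f) * (star x * (x * f))) <= 2 * (nrm x * nrm (x * f)).
  apply: le_trans (nrmM _ _) _; rewrite ler_pM ?nrm_ge0//.
  by apply: le_trans (nrmM _ _) _; rewrite nrm_star.
apply: le_lt_trans (le_trans (nrmD _ _) (lerD l1 l2)) _.
rewrite ltr_pdivlMr// in small; apply: le_lt_trans small; rewrite /K.
have := nrm_ge0 (x * f); move: (nrm x) (nrm (x * f)) => r s; nra.
Qed.

End Positivity.

(** * Compact open sets *)
Section CompactOpen.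
Context {T : topologicalType}.
Implicit Types A B C W : set T.

(** Were the claim false, the complements in [C] of the sets satisfying [P]
would generate a proper filter without cluster point in [C]. *)
Lemma compact_ind (P : set T -> Prop) C : compact C ->
  P set0 -> (forall A B, A `<=` B -> P B -> P A) ->
  (forall A B, P A -> P B -> P (A `|` B)) ->
  (forall x, C x -> exists2 W, nbhs x W & P W) -> P C.
Proof.
move=> cC P0 PS PU Pl; apply: contrapT => nPC.
pose F : set_system T := [set S | exists2 A, P A & C `\` A `<=` S].
have FF : ProperFilter F.
  split.
    move=> [A PA CA]; apply: nPC; apply: PS PA => x Cx.
    by apply: contrapT => nAx; apply: (CA x).
  split.
  - by exists set0.
  - move=> S1 S2 [A1 PA1 CA1] [A2 PA2 CA2]; exists (A1 `|` A2); first exact: PU.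
    by move=> x [Cx nAx]; split; [apply: CA1|apply: CA2]; split => // Ax; apply: nAx; [left|right].
  - by move=> S1 S2 S12 [A PA CA]; exists A => // x /CA/S12.
have FC : F C by exists set0 => // x [].
have [x [Cx clx]] := cC F FF FC.
have [W Ox PO] := Pl x Cx.
have FO : F (C `\` W) by exists W.
by have [y [[_ nO] Oy]] := clx _ _ FO Ox.
Qed.

Definition copen A := compact A /\ open A.

Lemma copenU A B : copen A -> copen B -> copen (A `|` B).
Proof. by move=> [cA oA] [cB oB]; split; [exact: compactU|exact: openU]. Qed.

Lemma copen0 : copen set0.
Proof. by split; [exact: compact0|exact: open0]. Qed.

Hypothesis hT : hausdorff_space T.

Lemma copen_closed A : copen A -> closed A.
Proof. by move=> [cA _]; exact: compact_closed. Qed.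

Lemma copenIr A B : copen A -> open B -> closed B -> copen (A `&` B).
Proof.
move=> [cA oA] oB cB; split; last exact: openI.
exact: compact_closedI.
Qed.

Lemma copenI A B : copen A -> copen B -> copen (A `&` B).
Proof. by move=> cA cB; apply: copenIr => //; [case: cB|exact: copen_closed]. Qed.

Lemma copenD A B : copen A -> copen B -> copen (A `\` B).
Proof.
move=> cA cB; apply: copenIr => //.
  by rewrite openC; exact: copen_closed.
by rewrite closedC; case: cB.
Qed.

(** Induction over partitions: compactness yields a finite cover by the sets
provided at the points of [K], which can be made disjoint since they are clopen. *)
Lemma copen_ind (P : set T -> Prop) K : copen K -> P set0 ->
  (forall A B, copen A -> copen B -> [disjoint A & B] -> P A -> P B -> P (A `|` B)) ->
  (forall x, K x -> exists2 W, copen W /\ W x &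
     forall A, A `<=` W -> copen A -> P A) -> P K.
Proof.
move=> Kc P0 PU Pl.
suff [W [_ KO]] : exists W, [/\ copen W, K `<=` W & forall A, A `<=` W -> copen A -> P A].
  by apply.
apply: (@compact_ind (fun S => exists W,
   [/\ copen W, S `<=` W & forall A, A `<=` W -> copen A -> P A]) K).
- by case: Kc.
- exists set0; split => //; first exact: copen0.
  by move=> A; rewrite subset0 => ->.
- move=> A B AB [W [Oc BO OP]]; exists W; split => //; exact: subset_trans BO.
- move=> A B [W [Oc AO OP]] [W' [Oc' BO OP']]; exists (W `|` W'); split.
  + exact: copenU.
  + exact: setUSS.
  + move=> S SO Sc; rewrite -(setUIDK S W).
    apply: PU; [exact: copenI|exact: copenD| | |].
    * by apply/disj_setPLR => x [_ Ox] [_].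
    * by apply: OP; [exact: subIsetr|exact: copenI].
    * by apply: OP'; [move=> x [Sx nOx]; case: (SO x Sx)|exact: copenD].
- move=> x /Pl[W [Oc Ox] OP]; exists W; last by exists W; split.
  by apply: open_nbhs_nbhs; split => //; case: Oc.
Qed.

Lemma separate_compacts C D : compact C -> compact D -> C `&` D = set0 ->
  exists U V, [/\ open U, open V, C `<=` U, D `<=` V & U `&` V = set0].
Proof.
have sep1 (x : T) (E : set T) : compact E -> ~ E x ->
    exists U V, [/\ open U, open V, U x, E `<=` V & U `&` V = set0].
  move=> cE nEx; apply: (@compact_ind (fun S => exists U V : set T,
    [/\ open U, open V, U x, S `<=` V & U `&` V = set0]) _ cE).
  - by exists setT, set0; rewrite setI0; split; [exact: openT|exact: open0| | |].
  - move=> A B AB [U [V [oU oV Ux BV UV]]]; exists U, V; split => //.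
    exact: subset_trans BV.
  - move=> A B [U [V [oU oV Ux AV UV]]] [U' [V' [oU' oV' U'x BV' UV']]].
    exists (U `&` U'), (V `|` V'); split.
    + exact: openI.
    + exact: openU.
    + by [].
    + exact: setUSS.
    + by apply/seteqP; split=> // y [[Uy U'y] [Vy|V'y]]; [rewrite -UV|rewrite -UV'].
  - move=> y Ey; have xy : x != y by apply/eqP => xy; rewrite xy in nEx.
    move: hT; rewrite open_hausdorff => /(_ _ _ xy)[[U V] /= [xU yV] [oU oV /eqP UV]].
    rewrite !inE in xU yV; exists V; first exact: open_nbhs_nbhs.
    by exists U, V; split.
move=> cC cD CD; apply: (@compact_ind (fun S => exists U V : set T,
    [/\ open U, open V, S `<=` U, D `<=` V & U `&` V = set0]) _ cC).
- by exists set0, setT; rewrite set0I; split; [exact: open0|exact: openT| | |].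
- move=> A B AB [U [V [oU oV BU DV UV]]]; exists U, V; split => //.
  exact: subset_trans BU.
- move=> A B [U [V [oU oV AU DV UV]]] [U' [V' [oU' oV' BU' DV' UV']]].
  exists (U `|` U'), (V `&` V'); split.
  + exact: openU.
  + exact: openI.
  + exact: setUSS.
  + by move=> x Dx; split; [exact: DV|exact: DV'].
  + by apply/seteqP; split=> // y [[Uy|U'y] [Vy V'y]]; [rewrite -UV|rewrite -UV'].
- move=> x Cx; have [|U [V [oU oV Ux DV UV]]] := sep1 x _ cD.
    by move=> Dx; have : (C `&` D) x by []; rewrite CD.
  exists U; first exact: open_nbhs_nbhs.
  by exists U, V; split.
Qed.

(** In a compact Hausdorff space the intersection of the clopen neighbourhoods
of a point is connected, hence reduced to the point here; by compactness one of
these neighbourhoods already fits into [W]. *)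
Lemma copen_base K x W : copen K -> totally_disconnected K -> K x -> open W -> W x ->
  exists2 N, copen N /\ N x & N `<=` W `&` K.
Proof.
move=> Kc tdK Kx oW Wx.
pose D (C : set T) := [/\ copen C, C `<=` K & C x].
have DI A B : D A -> D B -> D (A `&` B).
  move=> [cA AK Ax] [cB BK Bx]; split => //; first exact: copenI.
  by move=> y [/AK].
have DK : D K by split.
pose Q := \bigcap_(C in D) C.
have Qx : Q x by move=> C [].
have QK : Q `<=` K by move=> y; apply.
have small V : open V -> Q `<=` V -> exists2 C, D C & C `<=` V.
  move=> oV QV.
  suff [C DC CV] : exists2 C, D C & (K `\` V) `<=` ~` C.
    exists C => // y Cy; apply: contrapT => nVy; apply: (CV y) => //.
    by split => //; case: DC => _ + _; exact.
  apply: (@compact_ind (fun S => exists2 C, D C & S `<=` ~` C)).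
  - rewrite setDE; apply: compact_closedI; first by case: Kc.
    by rewrite closedC.
  - by exists K.
  - by move=> A B AB [C DC BC]; exists C => //; exact: subset_trans BC.
  - move=> A B [C DC AC] [C' DC' BC']; exists (C `&` C'); first exact: DI.
    by move=> y [/AC nC|/BC' nC] [].
  - move=> y [Ky nVy]; have : ~ Q y by move=> /QV.
    move=> /existsNP[C /not_implyP[DC nCy]].
    exists (~` C); last by exists C.
    by apply: open_nbhs_nbhs; split => //; rewrite openC; apply: copen_closed; case: DC.
have Qclosed : closed Q by apply: closed_bigI => C [/copen_closed].
have Qcompact C : closed C -> compact (Q `&` C).
  move=> cC; apply: (@subclosed_compact _ _ K); [exact: closedI|by case: Kc|].
  by move=> y [/QK].
have Qconn : connected Q.
  move=> B B0 [C1 oC1 BC1] [C2 cC2 BC2].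
  have [U [V [oU oV BU CV UV]]] :
      exists U V, [/\ open U, open V, B `<=` U, Q `&` ~` C1 `<=` V & U `&` V = set0].
    apply: separate_compacts.
    - by rewrite BC2; exact: Qcompact.
    - by apply: Qcompact; rewrite closedC.
    - by apply/seteqP; split=> // y [+ [_ nC]]; rewrite BC1 => -[_].
  have QUV : Q `<=` U `|` V.
    move=> y Qy; have [C1y|nC1y] := pselect (C1 y).
      by left; apply: BU; rewrite BC1.
    by right; apply: CV.
  have [C [Cc CK Cx] CUV] := small _ (openU oU oV) QUV.
  (* the part of [C] inside one of the two open sets is again clopen *)
  have part (U' V' : set T) : open U' -> open V' -> C `<=` U' `|` V' ->
      U' `&` V' = set0 -> U' x -> Q `<=` U'.
    move=> oU' oV' CU' UV' Ux; have : D (C `&` U').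
      split; [|by move=> y [/CK]|by []].
      have -> : C `&` U' = C `&` ~` V'.
        apply/seteqP; split=> y [Cy]; last by case: (CU' y Cy).
        by move=> U'y; split => // V'y; have : (U' `&` V') y by []; rewrite UV'.
      split; first by apply: compact_closedI; [case: Cc|rewrite closedC].
      have -> : C `&` ~` V' = C `&` U'.
        apply/seteqP; split=> y [Cy]; first by case: (CU' y Cy).
        by move=> U'y; split => // V'y; have : (U' `&` V') y by []; rewrite UV'.
      by apply: openI => //; case: Cc.
    by move=> DCU y /(_ _ DCU)[].
  have [Bx|nBx] := pselect (B x).
    have QU := part U V oU oV CUV UV (BU _ Bx).
    apply/seteqP; split=> [y|y Qy]; first by rewrite BC1 => -[].
    rewrite BC1; split => //; apply: contrapT => nC1y.
    by have : (U `&` V) y by [split; [exact: QU|exact: CV]]; rewrite UV.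
  have Vx : V x by apply: CV; split => // C1x; apply: nBx; rewrite BC1.
  have QV := part V U oV oU ltac:(by rewrite setUC) ltac:(by rewrite setIC) Vx.
  case: B0 => y By; have : (U `&` V) y; last by rewrite UV.
  by split; [exact: BU|apply: QV; move: By; rewrite BC1 => -[]].
have [N DN NW] := small _ oW ltac:(by
  move=> y Qy; have := connected_component_max Qx QK Qconn Qy; rewrite tdK// => ->).
exists N; first by case: DN.
by move=> y Ny; split; [exact: NW|case: DN => _ + _; exact].
Qed.

Lemma compact_sub_copen C : (forall x W, open W -> W x -> exists2 N, copen N /\ N x & N `<=` W) ->
  compact C -> exists2 K, copen K & C `<=` K.
Proof.
move=> base cC; apply: (@compact_ind (fun S => exists2 K, copen K & S `<=` K)) => //.
- by exists set0; [exact: copen0|].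
- by move=> A B AB [K Kc BK]; exists K => //; exact: subset_trans BK.
- move=> A B [K Kc AK] [L Lc BL]; exists (K `|` L); [exact: copenU|exact: setUSS].
- move=> x _; have [N [Nc Nx] _] := base x setT openT I.
  exists N; last by exists N.
  by apply: open_nbhs_nbhs; split => //; case: Nc.
Qed.

End CompactOpen.

(** * Groupoid arithmetic *)
Section GroupoidAlgebra.
Context {G : topologicalType} (g : groupoid G).
Local Notation s := (src g).
Local Notation r := (rng g).
Local Notation m := (gmul g).
Local Notation i := (ginv g).
Implicit Types x y : G.

Lemma ginvK x : i (i x) = x.
Proof.
have rii : r (i (i x)) = r x by rewrite rng_inv src_inv.
rewrite -{1}[i (i x)](gmul_rng g) rii -(gmulV g x) -gmulA ?gmulV.
- by rewrite rng_inv gmul_src.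
- by rewrite rng_inv.
- by rewrite rng_inv.
Qed.

Lemma unit_rng x : s x = x -> r x = x.
Proof. by move=> sx; rewrite -sx rng_src. Qed.

Lemma unit_inv x : s x = x -> i x = x.
Proof.
move=> sx; rewrite -[LHS](gmul_src g) src_inv (unit_rng sx) gmulVx//.
Qed.

Lemma gmulK x y : s x = r y -> m (i x) (m x y) = y.
Proof. by move=> xy; rewrite gmulA ?src_inv// gmulVx xy gmul_rng. Qed.

Lemma gmulVK x y : r x = r y -> m x (m (i x) y) = y.
Proof. by move=> xy; rewrite gmulA ?src_inv ?rng_inv// gmulV xy gmul_rng. Qed.

Definition sprod (A B : set G) : set G :=
  [set x | exists a b, [/\ A a, B b, s a = r b & x = m a b]].

Definition sinv (A : set G) : set G := i @^-1` A.

Lemma image_rng_sinv A : r @` sinv A = s @` A.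
Proof.
apply/seteqP; split=> _ [x Ax <-]; first by exists (i x) => //; rewrite src_inv.
by exists (i x); rewrite ?rng_inv// /sinv /= ginvK.
Qed.

Lemma image_src_sinv A : s @` sinv A = r @` A.
Proof.
apply/seteqP; split=> _ [x Ax <-]; first by exists (i x) => //; rewrite rng_inv.
by exists (i x); rewrite ?src_inv// /sinv /= ginvK.
Qed.

Lemma sinvK (A : set G) : sinv (sinv A) = A.
Proof. by apply/funext => x; rewrite /sinv /= ginvK. Qed.

Lemma sprod_sinvl (A : set G) : set_inj A r -> sprod (sinv A) A = s @` A.
Proof.
move=> rA; apply/seteqP; split=> [_ [a [b [Aa Ab ab ->]]]|_ [x Ax <-]].
  have iab : i a = b by apply: rA; rewrite ?inE// rng_inv.
  by exists b => //; rewrite -[a](ginvK) iab gmulVx.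
by exists (i x), x; split; rewrite /sinv /= ?ginvK ?src_inv ?gmulVx.
Qed.

Lemma sprod_sinvr (A : set G) : set_inj A s -> sprod A (sinv A) = r @` A.
Proof.
move=> sA; have sA' : set_inj (sinv A) r.
  move=> x y /set_mem Ax /set_mem Ay xy; rewrite -(ginvK x) -(ginvK y); congr (i _).
  by apply: sA; rewrite ?inE ?src_inv.
by rewrite -{1}[A]sinvK sprod_sinvl// image_src_sinv.
Qed.

Lemma sprod_unitr (A N : set G) : N `<=` unit_space g -> sprod A N = A `&` s @^-1` N.
Proof.
move=> NG; apply/seteqP; split=> [_ [a [n [Aa Nn an ->]]]|x [Ax Nx]].
  have nE : n = s a by rewrite an unit_rng//; exact: NG.
  by rewrite nE in Nn *; rewrite gmul_src.
by exists x, (s x); split; rewrite ?rng_src ?gmul_src.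
Qed.

End GroupoidAlgebra.

(** * Compact open bisections *)
Section AmpleGroupoid.
Context {G : topologicalType} {g : groupoid G}.
Hypothesis (g_ample : ample g) (g_unit_compact : compact (unit_space g)).
Local Notation s := (src g).
Local Notation r := (rng g).
Local Notation m := (gmul g).
Local Notation i := (ginv g).
Local Notation G0 := (unit_space g).
Implicit Types (x y : G) (A B W U V : set G).

Let hG : hausdorff_space G. Proof. by case: g_ample. Qed.

Lemma local_homeomorphism_continuous (f : G -> G) B :
  local_homeomorphism_onto f B -> continuous f.
Proof.
move=> [_ fl] x; have [U [oU Ux fU _ _]] := fl x.
have : {in U, continuous f} by rewrite -continuous_open_subspace.
by apply; rewrite inE.
Qed.

Lemma local_homeomorphism_open (f : G -> G) B W :
  local_homeomorphism_onto f B -> open B -> open W -> open (f @` W).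
Proof.
move=> [_ fl] oB oW; rewrite openE => _ [x Wx <-].
have [U [oU Ux fU [W' [oW' fUE]] [h [hK hc]]]] := fl x.
have fUx : (f @` U) (f x) by exists x.
have ofU : open (f @` U) by rewrite fUE; exact: openI.
have hcx : {in f @` U, continuous h} by rewrite -continuous_open_subspace.
have : nbhs (f x) (h @^-1` (W `&` U)).
  apply: hcx; first by rewrite inE.
  by rewrite hK//; apply: open_nbhs_nbhs; split; [exact: openI|].
move=> hW; have fUn : nbhs (f x) (f @` U) by exact: open_nbhs_nbhs.
rewrite /interior; near=> y.
have [z Uz zy] : (f @` U) y by near: y.
have [] : (h @^-1` (W `&` U)) y by near: y.
by rewrite -zy hK// => Wz _; exists z.
Unshelve. all: by end_near. Qed.

Lemma src_continuous : continuous s.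
Proof. by case: g_ample => _ _ _ [_ /local_homeomorphism_continuous]. Qed.

Lemma rng_continuous : continuous r.
Proof. by case: g_ample => _ _ _ [/local_homeomorphism_continuous]. Qed.

Lemma ginv_continuous : continuous i.
Proof. by case: g_ample => [[]]. Qed.

(** Near a unit [u], an arrow [y] and its range both lie in a set on which the
range map is injective; as they have the same range, they agree. *)
Lemma unit_open : open G0.
Proof.
case: g_ample => _ _ _ [[_ rl] _] _; rewrite openE => u su.
have [U [oU Uu _ _ [h [hK _]]]] := rl u.
have ru : r u = u by exact: unit_rng.
have : nbhs u (r @^-1` U) by apply: rng_continuous; rewrite ru; exact: open_nbhs_nbhs.
have : nbhs u U by exact: open_nbhs_nbhs.
move=> Un rUn; rewrite /interior; near=> y.
have Uy : U y by near: y.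
have Ury : U (r y) by near: y.
have <- : r y = y by rewrite -[RHS]hK// -{2}(rng_rng g y) hK.
by rewrite /unit_space /= src_rng.
Unshelve. all: by end_near. Qed.

Lemma unit_copen : copen G0.
Proof. by split; last exact: unit_open. Qed.

Lemma src_open W : open W -> open (s @` W).
Proof.
case: g_ample => _ _ _ [_ sl] _; apply: local_homeomorphism_open sl _; exact: unit_open.
Qed.

Lemma rng_open W : open W -> open (r @` W).
Proof.
case: g_ample => _ _ _ [rl _] _; apply: local_homeomorphism_open rl _; exact: unit_open.
Qed.

Definition cob A := bisection g A /\ copen A.

Lemma cob_copen A : cob A -> copen A. Proof. by case. Qed.

Lemma cob_sub A B : cob A -> B `<=` A -> copen B -> cob B.
Proof.
move=> [[Ar As] _] BA Bc; split => //; split=> x y /set_mem Bx /set_mem By.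
  by apply: Ar; rewrite inE; apply: BA.
by apply: As; rewrite inE; apply: BA.
Qed.

Lemma cob_srcI A x y : cob A -> A x -> A y -> s x = s y -> x = y.
Proof. by move=> [[_ As] _] Ax Ay; apply: As; rewrite inE. Qed.

Lemma cob_rngI A x y : cob A -> A x -> A y -> r x = r y -> x = y.
Proof. by move=> [[Ar _] _] Ax Ay; apply: Ar; rewrite inE. Qed.

Lemma cob_unit A : A `<=` G0 -> copen A -> cob A.
Proof.
move=> AG Ac; split => //; split=> x y /set_mem Ax /set_mem Ay.
  by rewrite !unit_rng//; apply: AG.
by rewrite (AG x Ax) (AG y Ay).
Qed.

Lemma src_copen A : copen A -> copen (s @` A).
Proof.
move=> [cA oA]; split; last exact: src_open.
by apply: continuous_compact => //; apply: continuous_subspaceT => ?; exact: src_continuous.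
Qed.

Lemma rng_copen A : copen A -> copen (r @` A).
Proof.
move=> [cA oA]; split; last exact: rng_open.
by apply: continuous_compact => //; apply: continuous_subspaceT => ?; exact: rng_continuous.
Qed.

Lemma src_image_unit A : s @` A `<=` G0.
Proof. by move=> _ [x _ <-]; exact: src_src. Qed.

Lemma rng_image_unit A : r @` A `<=` G0.
Proof. by move=> _ [x _ <-]; exact: src_rng. Qed.

Lemma copen_src_preimage A N : copen A -> copen N -> copen (A `&` s @^-1` N).
Proof.
move=> Ac Nc; apply: copenIr => //.
  by apply: open_comp => [? _|]; [exact: src_continuous|case: Nc].
by apply: closed_comp => [? _|]; [exact: src_continuous|exact: copen_closed].
Qed.

(** The local inverse of the source map carries small compact open sets of units to
compact open bisections. *)
Lemma cob_base x W : open W -> W x -> exists2 A, cob A /\ A x & A `<=` W.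
Proof.
move=> oW Wx; have [_ _ _ [[_ rl] [_ sl]] td] := g_ample.
have [U [oU Ux _ _ [h [hK _]]]] := rl x.
have [V [oV Vx _ [W' [oW' sVE]] [k [kK kc]]]] := sl x.
pose E := W `&` (U `&` V).
have oE : open E by apply: openI => //; exact: openI.
have Ex : E x by [].
have [N [Nc Nx] NE] : exists2 N, copen N /\ N (s x) & N `<=` (s @` E) `&` G0.
  apply: (copen_base hG unit_copen td); [exact: src_src|exact: src_open|].
  by exists x.
exists (E `&` s @^-1` N); last by move=> y [[]].
split=> //; split.
  split=> y z /set_mem[[_ [Uy Vy]] _] /set_mem[[_ [Uz Vz]] _] yz.
    by rewrite -(hK y)// yz hK.
  by rewrite -(kK y)// yz kK.
split; last first.
  by apply: openI => //; apply: open_comp => [? _|]; [exact: src_continuous|case: Nc].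
have -> : E `&` s @^-1` N = k @` N.
  apply/seteqP; split=> [y [Ey Ny]|_ [n Nn <-]].
    by exists (s y) => //; rewrite kK//; case: Ey => _ [].
  have [[y Ey yn] _] := NE n Nn; rewrite -yn kK; last by case: Ey => _ [].
  by split => //=; rewrite yn.
apply: continuous_compact; last by case: Nc.
apply: continuous_subspaceW kc => n /NE[[y Ey yn] _].
by exists y => //; case: Ey => _ [].
Qed.

Lemma cob_inv A : cob A -> cob (sinv g A).
Proof.
move=> Ac; split.
  split=> x y /set_mem Ax /set_mem Ay xy; rewrite -(ginvK g x) -(ginvK g y).
    by congr (i _); apply: (cob_srcI Ac) => //; rewrite !src_inv.
  by congr (i _); apply: (cob_rngI Ac) => //; rewrite !rng_inv.
split; last by apply: open_comp => [? _|]; [exact: ginv_continuous|case: Ac => _ []].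
have -> : sinv g A = i @` A.
  apply/seteqP; split=> [x Ax|_ [x Ax <-]]; first by exists (i x) => //; exact: ginvK.
  by rewrite /sinv /= ginvK.
apply: continuous_compact; last by case: Ac => _ [].
by apply: continuous_subspaceT => ?; exact: ginv_continuous.
Qed.

(** An arrow [x] near [m a b] has the range of some [a'] in [A] near [a], because the
range map is open, and then [x = m a' (m (i a') x)] with second factor in [B] by
continuity. *)
Lemma sprod_open A B : open A -> open B -> open (sprod g A B).
Proof.
move=> oA oB; rewrite openE => _ [a [b [Aa Bb ab ->]]].
have [[mc _] _ _ _ _] := g_ample.
have comp : composable g (i a, m a b) by rewrite /composable /= src_inv rng_mul.
have Bm : nbhs (from_subspace (composable g) (fun p => m p.1 p.2) (i a, m a b)) B.
  by rewrite /from_subspace /= gmulK//; exact: open_nbhs_nbhs.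
have := (subspace_continuousP _ _).1 mc _ comp _ Bm.
rewrite /nbhs /= /within => -[[N1 N2] /= [N1n N2n] NB].
have iN1 : nbhs a (i @^-1` N1) by exact: ginv_continuous.
have : nbhs a (A `&` i @^-1` N1) by apply: filterI => //; exact: open_nbhs_nbhs.
rewrite nbhsE => -[A' [oA' A'a] A'A].
have : nbhs (m a b) (r @^-1` (r @` A')).
  apply: rng_continuous; apply: open_nbhs_nbhs; split; first exact: rng_open.
  by rewrite rng_mul//; exists a.
move=> rA; rewrite /interior; near=> x.
have [a' A'a' ra'] : (r @` A') (r x) by near: x.
have N2x : N2 x by near: x.
have [Aa' N1a'] := A'A _ A'a'.
exists a', (m (i a') x); split => //.
- by apply: (NB (i a', x)); [split|rewrite /composable /= src_inv].
- by rewrite rng_mul ?src_inv// rng_inv.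
- by rewrite gmulVK.
Unshelve. all: by end_near. Qed.

(** The composable pairs form a closed set, so those in [A `*` B] are compact. *)
Lemma sprod_compact A B : compact A -> compact B -> compact (sprod g A B).
Proof.
move=> cA cB; have [[mc _] _ _ _ _] := g_ample.
have -> : sprod g A B = (fun p => m p.1 p.2) @` ((A `*` B) `&` composable g).
  apply/seteqP; split=> [x [a [b [Aa Bb ab ->]]]|_ [[a b] [[Aa Bb] ab] <-]].
    by exists (a, b).
  by exists a, b.
apply: continuous_compact; first by apply: continuous_subspaceW mc => p [].
apply: compact_closedI; first exact: compact_setX.
rewrite -openC openE => -[a b] /= /eqP ab.
move: hG; rewrite open_hausdorff => /(_ _ _ ab)[[U V] /= [aU bV] [oU oV /eqP UV]].
rewrite !inE in aU bV.
exists (s @^-1` U, r @^-1` V) => /=.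
  by split; [apply: src_continuous|apply: rng_continuous]; exact: open_nbhs_nbhs.
move=> [x y] /= [Ux Vy] xy; have : (U `&` V) (s x) by split => //; rewrite xy.
by rewrite UV.
Qed.

Lemma cob_mul A B : cob A -> cob B -> cob (sprod g A B).
Proof.
move=> Ac Bc; split.
  split=> x y /set_mem[a [b [Aa Bb ab ->]]] /set_mem[a' [b' [Aa' Bb' ab' ->]]].
    rewrite !rng_mul// => rr; have aa := cob_rngI Ac Aa Aa' rr; rewrite -aa in ab' *.
    by congr m; apply: (cob_rngI Bc) => //; rewrite -ab.
  rewrite !src_mul// => ss; have bb := cob_srcI Bc Bb Bb' ss; rewrite -bb in ab' *.
  by congr (m _ b); apply: (cob_srcI Ac) => //; rewrite ab.
case: Ac Bc => _ [cA oA] [_ [cB oB]].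
by split; [exact: sprod_compact|exact: sprod_open].
Qed.

End AmpleGroupoid.
Arguments cob {G} g A.

(** * Compactly supported functions and convolution *)
Section Functions.
Local Open Scope complex_scope.
Context {R : realType} {G : topologicalType}.
Hypothesis hG : hausdorff_space G.
Implicit Types (f h : G -> R[i]) (A B : set G).

(** [nrm] on the regular module [R[i]^o], with [R[i]] as domain. *)
Definition cnorm (z : R[i]) : R := complex.Re `|z|.

Lemma cnormE (z : R[i]) : `|z| = (cnorm z)%:C.
Proof. exact: (@normE R R[i]^o). Qed.

Lemma cnormr (t : R) : cnorm t%:C = `|t|.
Proof. by rewrite /cnorm normc_def /= expr0n addr0 sqrtr_sqr. Qed.

Lemma continuous_nrmP f : continuous (f : G -> R[i]^o) <->
  forall x (e : R), 0 < e -> \forall y \near x, cnorm (f x - f y) < e.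
Proof.
split=> [fc x e e0|fn x S].
  have : nbhs (f x : R[i]^o) [set z | cnorm (f x - z) < e].
    by apply/nbhs_nrmP; exists e.
  exact: fc.
move=> /nbhs_nrmP[e e0 eS]; apply: filterS (fn x e e0) => y; exact: eS.
Qed.

Lemma continuous_cnorm f : continuous (f : G -> R[i]^o) -> continuous (cnorm \o f).
Proof.
move=> /continuous_nrmP fc x; apply/cvgrPdist_lt => e e0.
apply: filterS (fc x e e0) => y; apply: le_lt_trans.
have := @nrmD R R[i]^o (f x - f y) (f y); rewrite subrK.
have := @nrmD R R[i]^o (f y - f x) (f x); rewrite subrK.
rewrite (@nrmC R R[i]^o (f y)) ler_norml /= /cnorm /nrm; lra.
Qed.

Lemma continuous_cnorm_sqr f :
  continuous (f : G -> R[i]^o) -> continuous (fun x => cnorm (f x) ^+ 2).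
Proof. by move=> /continuous_cnorm fc x; exact: (cvgM (fc x) (fc x)). Qed.

Lemma continuous_real_complex (u : G -> R) :
  continuous u -> continuous ((fun x => (u x)%:C) : G -> R[i]^o).
Proof.
move=> uc; apply/continuous_nrmP => x e e0.
have /cvgrPdist_lt/(_ e e0) := uc x; apply: filterS => y.
by rewrite -rmorphB /= cnormr.
Qed.

Lemma continuous_restrict f A : open A -> closed A ->
  continuous (f : G -> R[i]^o) -> continuous ((fun x => f x * \1_A x) : G -> R[i]^o).
Proof.
move=> oA cA /continuous_nrmP fc; apply/continuous_nrmP => x e e0.
have [Ax|nAx] := pselect (A x).
  have : nbhs x A by exact: open_nbhs_nbhs.
  apply: filterS2 (fc x e e0) => y xy Ay.
  by rewrite !indicE !mem_set// !mulr1.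
have : nbhs x (~` A) by apply: open_nbhs_nbhs; split=> //; rewrite openC.
apply: filterS => y nAy.
by rewrite !indicE !memNset// !mulr0 subrr (cnormr 0) normr0.
Qed.

Lemma Cc_support f A : continuous (f : G -> R[i]^o) -> compact A ->
  (forall x, f x != 0 -> A x) -> Cc f.
Proof.
move=> fc cA fA; split => //; apply: (subclosed_compact _ cA).
  exact: closed_closure.
rewrite [X in _ `<=` X]((closure_id A).1 (compact_closed hG cA)); exact: closureS.
Qed.

Lemma Cc_restrict f A : copen A -> continuous (f : G -> R[i]^o) ->
  Cc (fun x => f x * \1_A x).
Proof.
move=> Ac fc; apply: (@Cc_support _ A); last 1 first.
- move=> x; rewrite indicE; apply: contra_neqP => nAx.
  by rewrite memNset// mulr0.
- by apply: continuous_restrict => //; [case: Ac|exact: copen_closed].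
- by case: Ac.
Qed.

Lemma Cc_indic A : copen A -> Cc (\1_A : G -> R[i]).
Proof.
move=> Ac; have -> : \1_A = (fun x => (fun=> 1 : R[i]) x * \1_A x).
  by apply/funext => x; rewrite mul1r.
by apply: Cc_restrict => // x; exact: cvg_cst.
Qed.

Lemma Cc_linear (c : R[i]) f h : Cc f -> Cc h -> Cc (fun x => c * f x + h x).
Proof.
move=> [fc fs] [hc hs].
apply: (@Cc_support _ (closure [set x | f x != 0] `|` closure [set x | h x != 0])).
- have fc' : continuous (fun x => c *: (f x : R[i]^o)).
    by move=> x; apply: cvgZr; exact: fc.
  by move=> x; apply: (cvgD (fc' x) (hc x)).
- exact: compactU.
- move=> x; have [f0|f0 _] := eqVneq (f x) 0; last by left; exact: subset_closure.
  by rewrite f0 mulr0 add0r => h0; right; exact: subset_closure.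
Qed.

Lemma Cc0 : Cc ((fun=> 0) : G -> R[i]).
Proof.
apply: (@Cc_support _ set0); [by move=> x; exact: cvg_cst|exact: compact0|].
by move=> x; rewrite eqxx.
Qed.

Context (g : groupoid G).
Local Notation m := (gmul g).
Local Notation i := (ginv g).

(** When [f] lives on a set where the range map is injective, the sum defining
the convolution has at most one term. *)
Lemma convolution_bisection f h A a x : set_inj A (rng g) ->
  (forall y, f y != 0 -> A y) -> A a -> rng g a = rng g x ->
  convolution g f h x = f a * h (m (i a) x).
Proof.
move=> rA fA Aa ax; rewrite /convolution -(fsbig_widen [set (a, m (i a) x)]).
- by rewrite fsbig_set1.
- by move=> _ ->; split; rewrite /composable /= ?rng_mul ?gmulVK ?src_inv ?rng_inv.
- move=> [b c] [[/= bc bcx]] nbc /=.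
  have [f0|fb] := eqVneq (f b) 0; first by rewrite f0 mul0r.
  exfalso; apply: nbc.
  have ba : b = a.
    apply: rA; rewrite ?inE//; first exact: fA.
    by rewrite ax -bcx rng_mul.
  by rewrite -bcx -ba gmulK.
Qed.

Lemma convolution_out f h A x : (forall y, f y != 0 -> A y) ->
  (forall a, A a -> rng g a <> rng g x) -> convolution g f h x = 0.
Proof.
move=> fA Ax; apply: fsbig1 => -[b c] [/= bc bcx].
have [f0|fb] := eqVneq (f b) 0; first by rewrite /= f0 mul0r.
by exfalso; apply: (Ax b); [exact: fA|rewrite -bcx rng_mul].
Qed.

End Functions.

(** * Indicator functions in the completed groupoid algebra *)
Section Representation.
Local Open Scope complex_scope.
Context {R : realType} {G : topologicalType} {g : groupoid G}.
Hypothesis (g_ample : ample g) (g_unit_compact : compact (unit_space g)).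
Context {A : cstarAlgType R} {iota : (G -> R[i]) -> A}.
Hypothesis iota_morph : star_morphism g iota.
Hypothesis iota_dense : closure (iota @` Cc) = setT.
Local Notation s := (src g).
Local Notation r := (rng g).
Local Notation m := (gmul g).
Local Notation i := (ginv g).
Local Notation G0 := (unit_space g).
Implicit Types (f h : G -> R[i]) (K B W : set G).

Let hG : hausdorff_space G. Proof. by case: g_ample. Qed.

Lemma iota0 : iota (fun=> 0) = 0.
Proof.
have [lin _ _] := iota_morph.
have := lin 1 _ _ (Cc0 (R := R) hG) (Cc0 (R := R) hG).
rewrite (_ : (fun x => _) = (fun=> 0)); last by apply/funext => x; rewrite mulr0 addr0.
rewrite scale1r => H; apply: (@addrI _ (iota (fun=> 0))).
by rewrite addr0.
Qed.

Lemma iotaD f h : Cc f -> Cc h -> iota (fun x => f x + h x) = iota f + iota h.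
Proof.
have [lin _ _] := iota_morph => fc hc; rewrite -[iota f]scale1r -lin//.
by congr iota; apply/funext => x; rewrite mul1r.
Qed.

Lemma iotaZ c f : Cc f -> iota (fun x => c * f x) = c *: iota f.
Proof.
have [lin _ _] := iota_morph => fc.
have := lin c _ _ fc (Cc0 (R := R) hG); rewrite iota0 addr0 => <-.
by congr iota; apply/funext => x; rewrite addr0.
Qed.

Lemma iotaB f h : Cc f -> Cc h -> iota (fun x => f x - h x) = iota f - iota h.
Proof.
have [lin _ _] := iota_morph => fc hc; rewrite addrC -scaleN1r -lin//.
by congr iota; apply/funext => x; rewrite mulN1r addrC.
Qed.

Lemma iota_dense_sub (S : set A) : closed_subspace S ->
  (forall f, Cc f -> S (iota f)) -> forall a, S a.
Proof.
move=> hS Sf a; apply: (csub_lim hS) => e e0.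
have : closure (iota @` Cc) a by rewrite iota_dense.
by move=> /closure_nrmP/(_ _ e0)[_ [f fc <-] af]; exists (iota f) => //; exact: Sf.
Qed.

Lemma iota_unit_mul f : Cc f -> cmul (iota \1_G0) (iota f) = iota f.
Proof.
have [_ mul _] := iota_morph => fc.
rewrite -mul//; last by apply: Cc_indic => //; exact: unit_copen.
congr iota; apply/funext => x.
have G0r : unit_space g (r x) by exact: src_rng.
rewrite (@convolution_bisection _ _ _ _ _ G0 (r x)) ?rng_rng//.
- by rewrite indicE mem_set// mul1r unit_inv// gmul_rng.
- by have [[]] := cob_unit (fun _ p => p) (unit_copen g_ample g_unit_compact).
- by move=> y; rewrite indicE; apply: contra_neqP => nG; rewrite memNset.
Qed.

Lemma closed_subspace0 (V : normedModType R[i]) : closed_subspace [set 0 : V].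
Proof.
split=> //; last by move=> c a b -> ->; rewrite scaler0 addr0.
move=> x /closure_nrmP x0; apply: nrm_eq0; apply/eqP; rewrite eq_le nrm_ge0 andbT.
apply/ler_addgt0Pr => e /x0[_ ->]; rewrite subr0 add0r; exact: ltW.
Qed.

Lemma iota_unit_left_id : left_id (iota \1_G0) cmul.
Proof.
move=> a; apply/eqP; rewrite -subr_eq0; apply/eqP.
set e := iota _.
have hS : closed_subspace [set a | [set (0 : A)] (cmul e a - a)].
  apply: (@closed_subspace_preim R A A (fun a => cmul e a - a) (nrm e + 1)).
  - move=> x y; rewrite -[- y]scaleN1r cmulDr cmulZr !scaleN1r !opprD !opprK.
    by rewrite addrACA.
  - by move=> c x; exists c; rewrite cmulZr scalerBr.
  - move=> x; apply: le_trans (nrmB _ _) _; rewrite mulrDl mul1r lerD2r.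
    by rewrite -lecR rmorphM /= -!normE; exact: cnormM.
  - exact: closed_subspace0.
by apply: (iota_dense_sub hS) => f fc /=; rewrite iota_unit_mul// subrr.
Qed.

Lemma conjc_mul (z : R[i]) : conjc z * z = ((cnorm z) ^+ 2)%:C.
Proof.
rewrite rmorphXn /= -cnormE -add_Re2_Im2; case: z => a b /=.
by apply/eqP; rewrite eq_complex /=; apply/andP; split; apply/eqP; ring.
Qed.

Lemma cnorm_conjc (z : R[i]) : cnorm (conjc z) = cnorm z.
Proof. by rewrite /cnorm !normc_def; case: z => a b /=; rewrite sqrrN. Qed.

Lemma fstar_indic B : fstar g (\1_B : G -> R[i]) = \1_(sinv g B).
Proof. by apply/funext => x; rewrite /fstar !indicE conjc_nat. Qed.

Lemma iota_unit_star : star (iota \1_G0) = iota \1_G0.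
Proof.
have [_ _ st] := iota_morph.
rewrite -st; last by apply: Cc_indic => //; exact: unit_copen.
rewrite fstar_indic; congr (iota \1_ _); apply/seteqP; split=> x /=.
  by rewrite /sinv /unit_space /= => ix; rewrite -(ginvK g x) unit_inv.
by rewrite /sinv /unit_space /= => sx; rewrite unit_inv.
Qed.

Lemma iota_unit_right_id : right_id (iota \1_G0) cmul.
Proof. by move=> a; rewrite -[RHS]starK -{1}[a]starK -iota_unit_star -starM iota_unit_left_id. Qed.

(** The unit of [Cc] is a unit of the completion, which thus becomes a ring. *)
Local Notation U := (unital iota_unit_left_id iota_unit_right_id).

(** [iota] and its values on indicators, typed in the ring [U]. *)
Definition rho f : U := iota f.
Definition chi B : U := rho \1_B.

Lemma rhoD f h : Cc f -> Cc h -> rho (fun x => f x + h x) = rho f + rho h.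
Proof. exact: iotaD. Qed.

Lemma rhoZ c f : Cc f -> rho (fun x => c * f x) = c *: rho f.
Proof. exact: iotaZ. Qed.

Lemma rhoB f h : Cc f -> Cc h -> rho (fun x => f x - h x) = rho f - rho h.
Proof. exact: iotaB. Qed.

Lemma rhoM f h : Cc f -> Cc h -> rho (convolution g f h) = rho f * rho h.
Proof. by case: iota_morph => _ mul _; exact: mul. Qed.

Lemma rho_star f : Cc f -> rho (fstar g f) = star (rho f).
Proof. by case: iota_morph => _ _; exact. Qed.

Lemma chi0 : chi set0 = 0.
Proof.
by rewrite -[RHS]iota0; congr iota; apply/funext => x; rewrite indicE in_set0.
Qed.

Lemma chiU B W : copen B -> copen W -> [disjoint B & W] -> chi (B `|` W) = chi B + chi W.
Proof.
move=> Bc Wc BW; rewrite /chi -rhoD; [|exact: Cc_indic..].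
congr rho; apply/funext => x; rewrite !indicE in_setU.
case: (boolP (x \in B)) => [|_]; last by rewrite add0r.
rewrite inE => Bx; rewrite memNset ?addr0// => Wx.
by move: BW; rewrite disj_set2E => /eqP BW; have : (B `&` W) x by []; rewrite BW.
Qed.

Lemma chi_star B : cob g B -> star (chi B) = chi (sinv g B).
Proof.
by move=> [_ Bc]; rewrite /chi -fstar_indic rho_star//; exact: Cc_indic.
Qed.

Lemma chiM B W : cob g B -> cob g W -> chi B * chi W = chi (sprod g B W).
Proof.
move=> Bc Wc; rewrite /chi -rhoM; [|exact: (Cc_indic hG (cob_copen Bc))|exact: (Cc_indic hG (cob_copen Wc))].
congr rho; apply/funext => x.
have Bsupp y : (\1_B y : R[i]) != 0 -> B y.
  by rewrite indicE; apply: contra_neqP => nB; rewrite memNset.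
have [[b [Bb bx]]|nB] := pselect (exists b, B b /\ r b = r x).
  rewrite (@convolution_bisection _ _ _ _ _ B b)//; last by case: Bc => -[].
  rewrite !indicE mem_set// mul1r; congr (_%:R); congr nat_of_bool.
  apply/idP/idP => /set_mem H; apply/mem_set.
    exists b, (m (i b) x); split=> //; last by rewrite gmulVK.
    by rewrite rng_mul ?src_inv// rng_inv.
  case: H => b' [w [Bb' Ww b'w xE]]; rewrite xE.
  have -> : b = b' by apply: (cob_rngI Bc) => //; rewrite bx xE rng_mul.
  by rewrite gmulK.
rewrite (@convolution_out _ _ _ _ _ B)//; last first.
  by move=> b Bb bx; apply: nB; exists b.
rewrite indicE memNset// => -[b [w [Bb Ww bw xE]]].
by apply: nB; exists b; rewrite xE rng_mul.
Qed.

(** [F] is [u] transported to the unit space; it is continuous because the source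
map is open and injective on [K]. *)
Lemma Cc_src_image K (u F : G -> R[i]) : cob g K -> continuous (u : G -> R[i]^o) ->
  (forall b, K b -> F (s b) = u b) -> (forall x, ~ (s @` K) x -> F x = 0) -> Cc F.
Proof.
move=> Kc /continuous_nrmP uc FK F0; have [_ [cK oK]] := Kc.
have [csK osK] := src_copen g_ample (cob_copen Kc).
apply: (@Cc_support _ _ hG _ (s @` K)) => //; last first.
  by move=> x; apply: contra_neqP => /F0.
apply/continuous_nrmP => x e e0.
have [[b Kb <-]|nK] := pselect ((s @` K) x); last first.
  have : nbhs x (~` (s @` K)).
    apply: open_nbhs_nbhs; split=> //; rewrite openC; exact: copen_closed.
  by apply: filterS => y nKy; rewrite !F0// subrr (cnormr 0) normr0.
have : nbhs b (K `&` [set y | cnorm (u b - u y) < e]).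
  by apply: filterI; [exact: open_nbhs_nbhs|exact: uc].
rewrite nbhsE => -[N [oN Nb] NK].
have : nbhs (s b) (s @` N).
  by apply: open_nbhs_nbhs; split; [exact: src_open|exists b].
by apply: filterS => _ [y /NK[Ky by_] <-]; rewrite !FK.
Qed.

Lemma convolution_star_self K f b : cob g K -> (forall x, f x != 0 -> K x) -> K b ->
  convolution g (fstar g f) f (s b) = ((cnorm (f b)) ^+ 2)%:C.
Proof.
move=> Kc fK Kb; have [[Ki _] _] := cob_inv g_ample Kc.
rewrite (@convolution_bisection _ _ _ _ _ (sinv g K) (i b))//.
- by rewrite /fstar ginvK gmul_src conjc_mul.
- move=> y; rewrite /fstar /sinv /=; rewrite conjc_eq0; exact: fK.
- by rewrite /sinv /= ginvK.
- by rewrite rng_inv rng_src.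
Qed.

Lemma convolution_star_self_out K f x : cob g K -> (forall x, f x != 0 -> K x) ->
  ~ (s @` K) x -> convolution g (fstar g f) f x = 0.
Proof.
move=> Kc fK nx; have [[Ki _] _] := cob_inv g_ample Kc.
have supp y : fstar g f y != 0 -> sinv g K y.
  by rewrite /fstar /sinv /= conjc_eq0; exact: fK.
have [[a [Ka ax]]|nK] := pselect (exists a, sinv g K a /\ r a = r x); last first.
  by rewrite (@convolution_out _ _ _ _ _ (sinv g K))// => a Ka ax; apply: nK; exists a.
rewrite (@convolution_bisection _ _ _ _ _ (sinv g K) a)//.
have [->|/fK Kax] := eqVneq (f (m (i a) x)) 0; first by rewrite mulr0.
have iax : s (i a) = r x by rewrite src_inv.
have E : m (i a) x = i a by apply: (cob_rngI Kc) => //; rewrite rng_mul.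
exfalso; apply: nx; exists (i a) => //.
by rewrite -(gmulK iax) E gmulVx.
Qed.

Lemma Cc_fstar f : Cc f -> Cc (fstar g f).
Proof.
move=> [/continuous_nrmP fc fs]; have ic := ginv_continuous g_ample.
apply: (@Cc_support _ _ hG _ (sinv g (closure [set x | f x != 0]))).
- apply/continuous_nrmP => x e e0.
  have : nbhs x (i @^-1` [set y | cnorm (f (i x) - f y) < e]) by apply: ic; exact: fc.
  by apply: filterS => y; rewrite /fstar -rmorphB cnorm_conjc.
- have -> : sinv g (closure [set x | f x != 0]) = i @` (closure [set x | f x != 0]).
    apply/seteqP; split=> [x Hx|_ [x Hx <-]]; first by exists (i x); rewrite ?ginvK.
    by rewrite /sinv /= ginvK.
  by apply: continuous_compact => //; apply: continuous_subspaceT => ?; exact: ic.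
- by move=> x; rewrite /fstar conjc_eq0 /sinv /= => fx; exact: subset_closure.
Qed.

(** With [k = sqrt (eps^2 - |f|^2)] on [K], the sum of [star f * f] and [star k * k]
is [eps^2] times the projection [1_{s(K)}], and the norm is monotone on the
positive cone. *)
Lemma nrm_iota_le K f (eps : R) : cob g K -> Cc f -> (forall x, f x != 0 -> K x) ->
  0 <= eps -> (forall x, cnorm (f x) <= eps) -> nrm (rho f) <= eps.
Proof.
move=> Kc fc fK eps0 feps.
have fcont : continuous (f : G -> R[i]^o) by case: fc.
pose k0 x : R[i] := (Num.sqrt (eps ^+ 2 - cnorm (f x) ^+ 2))%:C.
pose k x := k0 x * \1_K x.
have k0c : continuous (k0 : G -> R[i]^o).
  apply: continuous_real_complex => x.
  apply: (@continuous_comp _ _ _ (fun x => eps ^+ 2 - cnorm (f x) ^+ 2) Num.sqrt).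
    apply: cvgB; first exact: cvg_cst.
    exact: continuous_cnorm_sqr.
  exact: sqrt_continuous.
have kc : Cc k by exact: (Cc_restrict hG (cob_copen Kc) k0c).
have kK x : k x != 0 -> K x.
  by apply: contra_neqP => nK; rewrite /k indicE memNset// mulr0.
have oneK x : (\1_K x : R[i]) != 0 -> K x.
  by apply: contra_neqP => nK; rewrite indicE memNset.
have onec : Cc (\1_K : G -> R[i]) by exact: (Cc_indic hG (cob_copen Kc)).
have convc h : Cc h -> (forall x, h x != 0 -> K x) -> Cc (convolution g (fstar g h) h).
  move=> hc hK; have hcont : continuous (h : G -> R[i]^o) by case: hc.
  have uc : continuous ((fun b => (cnorm (h b) ^+ 2)%:C) : G -> R[i]^o).
    by apply: continuous_real_complex; exact: continuous_cnorm_sqr.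
  apply: (Cc_src_image Kc uc).
    by move=> b Kb; apply: convolution_star_self Kb.
  by move=> x; apply: convolution_star_self_out.
have starM h : Cc h -> rho (convolution g (fstar g h) h) = star (rho h) * rho h.
  by move=> hc; rewrite (rhoM (Cc_fstar hc) hc) rho_star.
have main : star (rho f) * rho f + star (rho k) * rho k =
    (eps ^+ 2)%:C *: (star (chi K) * chi K) :> U.
  rewrite /chi -!starM// -(rhoZ _ (convc _ onec oneK)).
  rewrite -[LHS](rhoD (convc _ fc fK) (convc _ kc kK)).
  congr rho; apply/funext => x.
  have [[b Kb <-]|nx] := pselect ((s @` K) x); last first.
    by rewrite !(@convolution_star_self_out K)// mulr0 addr0.
  rewrite !(@convolution_star_self K)// -rmorphD -rmorphM /=; congr (_%:C).
  rewrite /k /k0 indicE mem_set// mulr1 !cnormr ger0_norm ?sqrtr_ge0// sqr_sqrtr.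
    by rewrite subrKC (normr1 R) expr1n mulr1.
  by rewrite subr_ge0 ler_sqr ?nnegrE// ; exact: (@nrm_ge0 R R[i]^o).
have p1 : nrm (star (chi K) * chi K) <= 1.
  set p := _ * _; have pp : star p * p = p.
    have Kr := Kc.1.1; have Ksc := src_copen g_ample (cob_copen Kc).
    have su := src_image_unit (g := g) (A := K).
    rewrite starMr starK -/p /p chi_star// chiM ?sprod_sinvl//; last exact: cob_inv.
    rewrite chiM; [|exact: cob_unit..].
    by rewrite sprod_unitr//; congr chi; apply/seteqP; split=> [x []//|x sx]; split => //=;
       rewrite (su x).
  by have := nrm_star_mul p; rewrite pp; move: (nrm p) => t; nra.
rewrite -ler_sqr ?nnegrE ?nrm_ge0// -nrm_star_mul.
apply: le_trans (posc_mono (posc_star_mul (rho f)) (posc_star_mul (rho k))) _.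
rewrite main nrmZr ger0_norm ?sqr_ge0//.
by rewrite -[leRHS]mulr1 ler_wpM2l ?sqr_ge0.
Qed.

(** A function in [Cc] is a sum of functions carried by bisections; each of them is a
uniform limit of locally constant functions, hence a norm limit by
[nrm_iota_le]. *)
Lemma rho_dense (S : set U) : closed_subspace S -> (forall W, cob g W -> S (chi W)) ->
  forall a, S a.
Proof.
move=> hS SW; apply: (iota_dense_sub hS) => f fc.
have fcont : continuous (f : G -> R[i]^o) by case: fc.
have base x W : open W -> W x -> exists2 N, copen N /\ N x & N `<=` W.
  by move=> oW Wx; have [N [[_ Nc] Nx] NW] := cob_base g_ample g_unit_compact oW Wx; exists N.
have [K Kc fK] := compact_sub_copen base fc.2.
have -> : f = fun x => f x * \1_K x.
  apply/funext => x; have [->|f0] := eqVneq (f x) 0; first by rewrite mul0r.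
  by rewrite indicE mem_set ?mulr1//; apply: fK; exact: subset_closure.
pose P B := S (rho (fun x => f x * \1_B x)).
have PU B W : copen B -> copen W -> [disjoint B & W] -> P B -> P W -> P (B `|` W).
  move=> Bc Wc BW PB PW; rewrite /P; have -> : (fun x => f x * \1_(B `|` W) x) =
      (fun x => f x * \1_B x + f x * \1_W x).
    apply/funext => x; rewrite -mulrDr; congr (_ * _); rewrite !indicE in_setU.
    case: (boolP (x \in B)) => [|_]; last by rewrite add0r.
    rewrite inE => Bx; rewrite memNset ?addr0// => Wx.
    by move: BW; rewrite disj_set2E => /eqP BW; have : (B `&` W) x by []; rewrite BW.
  by rewrite (rhoD (Cc_restrict hG Bc fcont) (Cc_restrict hG Wc fcont)); exact: (csubD hS).
have P0 : P set0.
  rewrite /P (_ : (fun x => _) = (fun=> 0)); first by rewrite [rho _]iota0; case: hS.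
  by apply/funext => x; rewrite indicE in_set0 mulr0.
apply: (copen_ind hG Kc P0 PU) => x Kx.
have [W0 [W0b W0x] _] := cob_base g_ample g_unit_compact openT (I : setT x).
exists W0; first by split => //; exact: (cob_copen W0b).
move=> B BW0 Bc; have Bb := cob_sub W0b BW0 Bc.
apply: (csub_lim hS) => eps eps0.
(* uniform approximation of [f] on [B] by a locally constant function *)
pose Q W := exists h, [/\ Cc h, S (rho h), forall y, h y != 0 -> W y &
  forall y, W y -> cnorm (f y - h y) <= eps / 2].
have [h [hc Sh hB fh]] : Q B.
  apply: (copen_ind hG Bc).
  - exists (fun=> 0); split.
    + exact: Cc0.
    + by rewrite [rho _]iota0; case: hS.
    + by move=> y; rewrite eqxx.
    + by move=> y [].
  - move=> W W' Wc Wc' WW' [h [hc Sh hW fh]] [h' [hc' Sh' hW' fh']].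
    have WWF y : W y -> W' y -> False.
      by move=> Wy W'y; move: WW'; rewrite disj_set2E => /eqP WW'; have : (W `&` W') y by []; rewrite WW'.
    exists (fun y => h y + h' y); split.
    + by have := Cc_linear hG 1 hc hc'; under eq_fun do rewrite mul1r.
    + by rewrite (rhoD hc hc'); exact: (csubD hS).
    + move=> y; have [->|h0 _] := eqVneq (h y) 0; last by left; exact: hW.
      by rewrite add0r => h'0; right; exact: hW'.
    + move=> y [Wy|Wy].
        have [->|/hW' W'y] := eqVneq (h' y) 0; first by rewrite addr0; exact: fh.
        by case: (WWF y).
      have [->|/hW Wy'] := eqVneq (h y) 0; first by rewrite add0r; exact: fh'.
      by case: (WWF y).
  - have eps2 : 0 < eps / 2 by lra.
    move=> y By.
    have : nbhs y [set z | cnorm (f y - f z) < eps / 2].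
      exact: (continuous_nrmP f).1 fcont y _ eps2.
    rewrite nbhsE => -[N [oN Ny] NE].
    have [W [Wb Wy] WN] := cob_base g_ample g_unit_compact oN Ny.
    exists W; first by split => //; exact: (cob_copen Wb).
    move=> W' W'W W'c; exists (fun z => f y * \1_W' z); split.
    + have cc : continuous ((fun=> f y) : G -> R[i]^o) by move=> z; exact: cvg_cst.
      exact: (Cc_restrict hG W'c cc).
    + rewrite (rhoZ _ (Cc_indic hG W'c)).
      by apply: (csubZ hS); apply: SW; exact: (cob_sub Wb W'W W'c).
    + by move=> z; apply: contra_neqP => nz; rewrite indicE memNset// mulr0.
    + move=> z W'z; rewrite indicE mem_set// mulr1.
      by rewrite [cnorm _](@nrmC R R[i]^o); apply/ltW/NE/WN/W'W.
exists (rho h) => //; rewrite -(rhoB (Cc_restrict hG Bc fcont) hc).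
apply: (@le_lt_trans _ _ (eps / 2)); last by lra.
have supp y : ~ B y -> f y * \1_B y - h y = 0.
  move=> nBy; rewrite indicE memNset// mulr0 sub0r.
  by have [->|/hB//] := eqVneq (h y) 0; rewrite oppr0.
apply: (nrm_iota_le Bb).
- have := Cc_linear hG (-1) hc (Cc_restrict hG Bc fcont).
  by under eq_fun do rewrite mulN1r addrC.
- by move=> y; apply: contra_neqP => /supp.
- by lra.
- move=> y; have [By|nBy] := pselect (B y).
    by rewrite indicE mem_set// mulr1; exact: fh.
  by rewrite supp// (cnormr 0) normr0; lra.
Qed.

End Representation.

(** * The topological full group *)
Section FullGroup.
Context {G : topologicalType} {g : groupoid G}.
Hypothesis (g_ample : ample g) (g_unit_compact : compact (unit_space g)).
Local Notation s := (src g).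
Local Notation r := (rng g).
Local Notation m := (gmul g).
Local Notation i := (ginv g).
Local Notation G0 := (unit_space g).
Local Notation full := (topological_full_group g).
Implicit Types (x y : G) (A B C N V W : set G).

Let hG : hausdorff_space G. Proof. by case: g_ample. Qed.

Lemma full_cob V : full V -> cob g V.
Proof. by move=> [Vb cV oV _ _]. Qed.

Lemma full_of_cob V : cob g V -> r @` V = G0 -> s @` V = G0 -> full V.
Proof. by move=> [Vb [cV oV]] rV sV; split. Qed.

Lemma full_mul V W : full V -> full W -> full (sprod g V W).
Proof.
move=> Vf Wf; have [_ _ _ rV sV] := Vf; have [_ _ _ rW sW] := Wf.
apply: full_of_cob.
- by apply: (cob_mul g_ample); exact: full_cob.
- apply/seteqP; split=> x; first exact: rng_image_unit.
  rewrite -rV => -[v Vv vx].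
  have : (r @` W) (s v) by rewrite rW; exact: src_src.
  by move=> [w Ww wv]; exists (m v w); [exists v, w|rewrite rng_mul].
- apply/seteqP; split=> x; first exact: src_image_unit.
  rewrite -sW => -[w Ww wx].
  have : (s @` V) (r w) by rewrite sV; exact: src_rng.
  by move=> [v Vv vw]; exists (m v w); [exists v, w|rewrite src_mul].
Qed.

Lemma full_inv V : full V -> full (sinv g V).
Proof.
move=> Vf; have [_ _ _ rV sV] := Vf; apply: full_of_cob.
- by apply: (cob_inv g_ample); exact: full_cob.
- by rewrite image_rng_sinv.
- by rewrite image_src_sinv.
Qed.

Lemma cobU B C : cob g B -> cob g C -> r @` B `&` r @` C = set0 ->
  s @` B `&` s @` C = set0 -> cob g (B `|` C).
Proof.
move=> Bc Cc rBC sBC; split; last by apply: copenU; [exact: (cob_copen Bc)|exact: (cob_copen Cc)].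
have dr x y : B x -> C y -> r x = r y -> False.
  move=> Bx Cy xy; have : (r @` B `&` r @` C) (r x) by split; [exists x|exists y].
  by rewrite rBC.
have ds x y : B x -> C y -> s x = s y -> False.
  move=> Bx Cy xy; have : (s @` B `&` s @` C) (s x) by split; [exists x|exists y].
  by rewrite sBC.
split=> x y /set_mem[Bx|Cx] /set_mem[By|Cy] xy.
- exact: (cob_rngI Bc).
- by case: (dr x y).
- by case: (dr y x).
- exact: (cob_rngI Cc).
- exact: (cob_srcI Bc).
- by case: (ds x y).
- by case: (ds y x).
- exact: (cob_srcI Cc).
Qed.

(** The involution exchanging the source and the range of a bisection. *)
Definition swap B := (B `|` sinv g B) `|` (G0 `\` (s @` B `|` r @` B)).

Lemma unit_image_src N : N `<=` G0 -> s @` N = N.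
Proof.
move=> NG; apply/seteqP; split=> [_ [x Nx <-]|x Nx]; first by rewrite (NG x Nx).
by exists x => //; exact: NG.
Qed.

Lemma unit_image_rng N : N `<=` G0 -> r @` N = N.
Proof.
move=> NG; apply/seteqP; split=> [_ [x Nx <-]|x Nx].
  by rewrite unit_rng//; exact: NG.
by exists x => //; apply: unit_rng; exact: NG.
Qed.

Lemma swap_full B : cob g B -> s @` B `&` r @` B = set0 -> full (swap B).
Proof.
move=> Bc sr.
have sB := src_copen g_ample (cob_copen Bc); have rB := rng_copen g_ample (cob_copen Bc).
have NG : G0 `\` (s @` B `|` r @` B) `<=` G0 by move=> x [].
have Nc : cob g (G0 `\` (s @` B `|` r @` B)).
  apply: (cob_unit NG); apply: (copenD hG); last exact: copenU.
  exact: (unit_copen g_ample g_unit_compact).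
have Uc : cob g (B `|` sinv g B).
  apply: (cobU Bc (cob_inv g_ample Bc)); first by rewrite image_rng_sinv setIC.
  by rewrite image_src_sinv.
have E : (s @` B `|` r @` B) `|` G0 `\` (s @` B `|` r @` B) = G0.
  rewrite setDUK// => x [|]; [exact: src_image_unit|exact: rng_image_unit].
apply: full_of_cob.
- apply: (cobU Uc Nc).
    rewrite image_setU image_rng_sinv (unit_image_rng NG).
    by apply/seteqP; split=> // y [H [_ nH]]; apply: nH; case: H; [right|left].
  rewrite image_setU image_src_sinv (unit_image_src NG).
  by apply/seteqP; split=> // y [H [_ nH]]; apply: nH.
- rewrite /swap !image_setU image_rng_sinv (unit_image_rng NG).
  by rewrite (setUC (r @` B)).
- by rewrite /swap !image_setU image_src_sinv (unit_image_src NG).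
Qed.

(** A quantifier for properties that are available only close to [x], each on its own
neighbourhood. *)
Definition small x (P : set G -> Prop) :=
  exists2 W, open W /\ W x & forall N, copen N -> N `<=` W -> P N.

Lemma small2 x (P Q S : set G -> Prop) : small x P -> small x Q ->
  (forall N, P N -> Q N -> S N) -> small x S.
Proof.
move=> [V [oV Vx] VP] [W [oW Wx] WQ] PQS; exists (V `&` W); first by split; [exact: openI|].
move=> N Nc NVW; apply: PQS; first by apply: VP => // y /NVW[].
by apply: WQ => // y /NVW[].
Qed.

Definition slice B N := B `&` s @^-1` N.

Lemma small_src x B : cob g B -> (s @` B) x -> small x (fun N =>
  [/\ copen N, N `<=` G0, cob g (slice B N) & s @` slice B N = N]).
Proof.
move=> Bc Bx; have [_ oB] := cob_copen Bc.
exists (s @` B); first by split=> //; exact: src_open.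
move=> N Nc NB; split=> //.
- by move=> y /NB; exact: src_image_unit.
- apply: (cob_sub Bc); first by move=> y [].
  exact: (copen_src_preimage g_ample (cob_copen Bc) Nc).
- apply/seteqP; split=> [_ [y [_ Ny] <-]//|y Ny].
  by have [b Bb by_] := NB _ Ny; exists b => //; split=> //=; rewrite /preimage /= by_.
Qed.

Lemma small_disjoint B C b c : cob g B -> cob g C -> B b -> C c ->
  s b = s c -> r b <> r c ->
  small (s b) (fun N => r @` slice B N `&` r @` slice C N = set0).
Proof.
move=> Bc Cc Bb Cc' bc /eqP rbc.
move: hG; rewrite open_hausdorff => /(_ _ _ rbc)[[U V] /= [bU cV] [oU oV /eqP UV]].
rewrite !inE in bU cV.
have rc := rng_continuous g_ample.
have [_ oB] := cob_copen Bc; have [_ oC] := cob_copen Cc.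
exists (s @` (B `&` r @^-1` U) `&` s @` (C `&` r @^-1` V)).
  split; last by split; [exists b|exists c].
  by apply: openI; apply: (src_open g_ample); apply: openI => //; apply: open_comp => // ? _; exact: rc.
move=> N _ NW; apply/seteqP; split=> // _ [[y [By Ny] <-] [z [Cz Nz] zy]].
have [[y' [By' Uy'] yy'] _] := NW _ Ny.
have [_ [z' [Cz' Vz'] zz']] := NW _ Nz.
rewrite (cob_srcI Bc By' By yy') in Uy'; rewrite (cob_srcI Cc Cz' Cz zz') in Vz'.
have : (U `&` V) (r y) by split; [|rewrite -zy].
by rewrite UV.
Qed.

End FullGroup.

(** * Corners of the span of [1 - 1_V] *)
Section Corner.
Local Open Scope complex_scope.
Context {R : realType} {G : topologicalType} {g : groupoid G}.
Hypothesis (g_ample : ample g) (g_unit_compact : compact (unit_space g)).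
Hypothesis g_orbits : forall x, unit_space g x -> `I_3 #<= gorbit g x.
Context {A : cstarAlgType R} {iota : (G -> R[i]) -> A}.
Hypothesis iota_morph : star_morphism g iota.
Hypothesis iota_dense : closure (iota @` Cc) = setT.
Local Notation s := (src g).
Local Notation r := (rng g).
Local Notation m := (gmul g).
Local Notation i := (ginv g).
Local Notation G0 := (unit_space g).
Local Notation full := (topological_full_group g).
Local Notation U := (unital
  (iota_unit_left_id g_ample g_unit_compact iota_morph iota_dense)
  (iota_unit_right_id g_ample g_unit_compact iota_morph iota_dense)).
Local Notation chi := (chi g_ample g_unit_compact iota_morph iota_dense).
Local Notation slice := (slice (g := g)).
Implicit Types (x y : G) (B C N V W X : set G) (a b t : U).

Let hG : hausdorff_space G. Proof. by case: g_ample. Qed.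

(** The closed image of the augmentation ideal of the group algebra of the full
group. *)
Definition augmentation : set U :=
  closed_span [set iota \1_G0 - iota \1_V | V in full].
Local Notation M := augmentation.

Lemma augmentation_closed_subspace : closed_subspace M.
Proof. exact: closed_span_closed_subspace. Qed.
Let hM := augmentation_closed_subspace.

Lemma augmentation_gen V : full V -> M (1 - chi V).
Proof. by move=> Vf; apply: sub_closed_span; exists V. Qed.

Lemma augmentation_ind (S : set U) : closed_subspace S ->
  (forall V, full V -> S (1 - chi V)) -> M `<=` S.
Proof. by move=> hS SV; apply: (closed_span_min hS) => _ [V Vf <-]; exact: SV. Qed.

Lemma chiM_full V W : full V -> full W -> chi V * chi W = chi (sprod g V W).
Proof. by move=> Vf Wf; apply: chiM; exact: full_cob. Qed.

Lemma augmentation_star a : M a -> M (star a).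
Proof.
move: a; apply: augmentation_ind; first exact: (closed_subspace_star hM).
move=> V Vf /=; rewrite starB star1 chi_star; last exact: full_cob.
by apply: augmentation_gen; exact: full_inv.
Qed.

Lemma augmentation_chi_mul V a : full V -> M a -> M (chi V * a).
Proof.
move=> Vf; move: a; apply: augmentation_ind.
  have := closed_subspace_mul (chi V) 1 hM.
  by rewrite (_ : [set a | _] = [set a : U | M (chi V * a)])//; apply/funext => a /=; rewrite mulr1.
move=> W Wf /=; rewrite mulrBr mulr1 chiM_full//.
rewrite (_ : _ - _ = (1 - chi (sprod g V W)) - (1 - chi V)); last by ncring.
by apply: (csubB hM); apply: augmentation_gen => //; exact: full_mul.
Qed.

Lemma augmentation_mul a b : M a -> M b -> M (a * b).
Proof.
move=> + Mb; move: a; apply: augmentation_ind.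
  have := closed_subspace_mul 1 b hM.
  by rewrite (_ : [set a | _] = [set a : U | M (a * b)])//; apply/funext => a /=; rewrite mul1r.
move=> V Vf /=; rewrite mulrBl mul1r.
by apply: (csubB hM) => //; exact: augmentation_chi_mul.
Qed.

Lemma chi_swap B : cob g B -> s @` B `&` r @` B = set0 ->
  chi (swap (g := g) B) =
  1 - star (chi B) * chi B - chi B * star (chi B) + chi B + star (chi B).
Proof.
move=> Bc sr; have Bi := cob_inv g_ample Bc.
have [[rI sI] Bco] := Bc; have [_ Bico] := Bi.
have sB := src_copen g_ample Bco; have rB := rng_copen g_ample Bco.
have Xc := copenU sB rB.
have XG : s @` B `|` r @` B `<=` G0.
  by move=> x [|]; [exact: src_image_unit|exact: rng_image_unit].
have Gc := unit_copen g_ample g_unit_compact.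
have Nc := copenD hG Gc Xc.
have notsr x : (s @` B) x -> (r @` B) x -> False.
  by move=> sx rx; have : (s @` B `&` r @` B) x by []; rewrite sr.
have d1 : [disjoint s @` B & r @` B] by rewrite disj_set2E sr.
have d2 : [disjoint s @` B `|` r @` B & G0 `\` (s @` B `|` r @` B)].
  by rewrite disj_set2E setDIK.
have d3 : [disjoint B & sinv g B].
  rewrite disj_set2E; apply/eqP/seteqP; split=> // x [Bx iBx].
  by apply: (notsr (s x)); [exists x|exists (i x) => //; rewrite rng_inv].
have d4 : [disjoint B `|` sinv g B & G0 `\` (s @` B `|` r @` B)].
  rewrite disj_set2E; apply/eqP/seteqP; split=> // x [H [xG nX]]; apply: nX; left.
  case: H => [Bx|iBx]; first by exists x.
  by exists (i x) => //; rewrite src_inv unit_rng.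
rewrite /swap chiU//; last exact: copenU.
rewrite [chi (B `|` _)]chiU// -(chi_star g_ample)//.
have E : chi (s @` B) + chi (r @` B) + chi (G0 `\` (s @` B `|` r @` B)) = 1.
  by rewrite -chiU// -chiU// setDUK.
have -> : star (chi B) * chi B = chi (s @` B).
  by rewrite chi_star// chiM// sprod_sinvl.
have -> : chi B * star (chi B) = chi (r @` B).
  by rewrite chi_star// chiM// sprod_sinvr.
by rewrite -E; ncring.
Qed.

Lemma chi_src B : cob g B -> star (chi B) * chi B = chi (s @` B).
Proof.
by move=> Bc; rewrite chi_star// chiM ?sprod_sinvl//; [case: Bc => -[]|exact: cob_inv].
Qed.

Lemma chi_slice B N : cob g B -> copen N -> N `<=` G0 -> chi B * chi N = chi (slice B N).
Proof. by move=> Bc Nc NG; rewrite chiM ?sprod_unitr//; exact: cob_unit. Qed.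

Lemma chi_orth B C : cob g B -> cob g C -> r @` B `&` r @` C = set0 ->
  star (chi B) * chi C = 0.
Proof.
move=> Bc Cc BC; rewrite chi_star// chiM//; last exact: (cob_inv g_ample Bc).
have E : sprod g (sinv g B) C = set0; last by rewrite E chi0.
apply/seteqP; split=> // x [a [c [Ba Cc' ac _]]].
have : (r @` B `&` r @` C) (r c); last by rewrite BC.
by split; [exists (i a) => //; rewrite rng_inv|exists c].
Qed.

(** Multiplication by the involution built on [B C^-1] sends [chi C] to [chi B] and
fixes [chi X], whose range is disjoint from theirs. *)
Lemma augmentation_swap N X C B t : copen N -> N `<=` G0 ->
  cob g X -> cob g C -> cob g B ->
  s @` X = N -> s @` C = N -> s @` B = N ->
  r @` X `&` r @` C = set0 -> r @` X `&` r @` B = set0 -> r @` C `&` r @` B = set0 ->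
  M ((chi X - chi C) * t) -> M ((chi X - chi B) * t).
Proof.
move=> Nc NG Xc Cc Bc sX sC sB XC XB CB Mt.
set n := chi N; set c := chi C; set b := chi B; set xi := chi X.
have cc : star c * c = n by rewrite chi_src// sC.
have bb : star b * b = n by rewrite chi_src// sB.
have sl D : cob g D -> s @` D = N -> chi D * n = chi D.
  move=> Dc sD; rewrite chi_slice//; congr (chi _); apply/seteqP; split=> [x []//|x Dx].
  by split => //=; rewrite /preimage /= -sD; exists x.
have cn : c * n = c by exact: sl.
have bn : b * n = b by exact: sl.
have cx : star c * xi = 0 by apply: chi_orth => //; rewrite setIC.
have bx : star b * xi = 0 by apply: chi_orth => //; rewrite setIC.
have bc : star b * c = 0 by apply: chi_orth => //; rewrite setIC.
pose E := sprod g B (sinv g C).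
have Ec : cob g E by apply: (cob_mul g_ample Bc); exact: cob_inv.
have eE : chi E = b * star c by rewrite chi_star// chiM//; exact: cob_inv.
have sr : s @` E `&` r @` E = set0.
  apply/seteqP; split=> // x [[_ [b1 [c1 [Bb1 Cc1 bc1 ->]]] xE] [_ [b2 [c2 [Bb2 Cc2 bc2 ->]]] xE']].
  have : (r @` C `&` r @` B) x; last by rewrite CB.
  split; first by exists (i c1) => //; rewrite rng_inv -xE src_mul.
  by exists b2 => //; rewrite -xE' rng_mul.
have sw : chi (swap (g := g) E) = 1 - c * star c - b * star b + b * star c + c * star b.
  rewrite chi_swap// eE starMr starK; congr (_ - _ - _ + _ + _).
    by rewrite mulrA -[c * _ * b]mulrA bb cn.
  by rewrite mulrA -[b * _ * c]mulrA cc bn.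
have -> : (xi - b) * t = chi (swap (g := g) E) * ((xi - c) * t).
  rewrite sw mulrA; congr (_ * t).
  have -> : (1 - c * star c - b * star b + b * star c + c * star b) * (xi - c) =
    xi - c - c * (star c * xi) + c * (star c * c) - b * (star b * xi) + b * (star b * c)
    + b * (star c * xi) - b * (star c * c) + c * (star b * xi) - c * (star b * c) by ncring.
  by rewrite cc cx bx bc cn bn; ncring.
by apply: augmentation_chi_mul => //; exact: swap_full.
Qed.

(** The involution exchanging [N] with the range of [C] is
[1 - chi N - chi C * star (chi C) + chi C + star (chi C)], and [1] minus it is the
product below. *)
Lemma augmentation_diag N C : copen N -> N `<=` G0 -> cob g C -> s @` C = N ->
  N `&` r @` C = set0 -> M ((chi N - chi C) * star (chi N - chi C)).
Proof.
move=> Nc NG Cc sC NC.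
have sr : s @` C `&` r @` C = set0 by rewrite sC.
have -> : (chi N - chi C) * star (chi N - chi C) = 1 - chi (swap (g := g) C).
  rewrite chi_swap// chi_src// sC starB.
  have NN : star (chi N) * chi N = chi N.
    by rewrite chi_src ?unit_image_src//; exact: cob_unit.
  have Ns : star (chi N) = chi N by rewrite -{1}NN starMr starK NN.
  have cN : chi C * chi N = chi C.
    rewrite chi_slice//; congr (chi _); apply/seteqP; split=> [x []//|x Cx].
    by split => //=; rewrite /preimage /= -sC; exists x.
  have Nc' : chi N * star (chi C) = star (chi C) by rewrite -{1}Ns -starMr cN.
  rewrite mulrBr !mulrBl Nc' Ns cN -{1}Ns NN.
  by ncring.
by apply: augmentation_gen; exact: swap_full.
Qed.

Local Notation delta B N := (chi N - chi (slice B N)).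

Section AtPoint.
Variables (x : G) (xG : G0 x).

Lemma small_swap (X C B : set G) (a c b : G) : cob g X -> cob g C -> cob g B ->
  X a -> C c -> B b -> s a = x -> s c = x -> s b = x ->
  r a <> r c -> r a <> r b -> r c <> r b ->
  small x (fun N => forall t, M ((chi (slice X N) - chi (slice C N)) * t) ->
     M ((chi (slice X N) - chi (slice B N)) * t)).
Proof.
move=> Xc Cc Bc Xa Cc' Bb sa sc sb ac ab cb.
have sX : small x (fun N => [/\ copen N, N `<=` G0, cob g (slice X N) & s @` slice X N = N]).
  by apply: (small_src g_ample Xc); exists a.
have sC : small x (fun N => [/\ copen N, N `<=` G0, cob g (slice C N) & s @` slice C N = N]).
  by apply: (small_src g_ample Cc); exists c.
have sB : small x (fun N => [/\ copen N, N `<=` G0, cob g (slice B N) & s @` slice B N = N]).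
  by apply: (small_src g_ample Bc); exists b.
have XC := small_disjoint g_ample Xc Cc Xa Cc' (etrans sa (esym sc)) ac.
have XB := small_disjoint g_ample Xc Bc Xa Bb (etrans sa (esym sb)) ab.
have CB := small_disjoint g_ample Cc Bc Cc' Bb (etrans sc (esym sb)) cb.
rewrite sa in XC XB; rewrite sc in CB.
have S1 := small2 sX sC (fun N p q => conj p q).
have S2 := small2 S1 sB (fun N p q => conj p q).
have D1 := small2 XC XB (fun N p q => conj p q).
have D2 := small2 D1 CB (fun N p q => conj p q).
apply: (small2 S2 D2) => N [[[Nc NG X1 X2] [_ _ C1 C2]] [_ _ B1 B2]] [[d1 d2] d3] t.
exact: (augmentation_swap Nc NG X1 C1 B1 X2 C2 B2 d1 d2 d3).
Qed.

Lemma unit_slice N : N `<=` G0 -> slice G0 N = N.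
Proof.
move=> NG; apply/seteqP; split=> [y [yG]|y Ny]; first by rewrite /preimage /= yG.
by split; [exact: NG|rewrite /preimage /= (NG y Ny)].
Qed.

Lemma exists_two_arrows : exists c d, [/\ s c = x, s d = x,
  r c <> x, r d <> x & r c <> r d].
Proof.
have /card_leP[f] := g_orbits xG.
pose I3 k (k3 : (k < 3)%N) : `I_3 := SigSub (mem_set (k3 : `I_3 k)).
have fo k (k3 : (k < 3)%N) : exists2 c, s c = x & r c = val (f (I3 k k3)).
  by have := set_valP (f (I3 k k3)) => -[c cx <-]; exists c.
have fi k l (k3 : (k < 3)%N) (l3 : (l < 3)%N) : k != l ->
    val (f (I3 k k3)) <> val (f (I3 l l3)).
  move=> /eqP kl /val_inj fkl; apply: kl.
  have : I3 k k3 = I3 l l3 by apply: (@inj _ _ _ f) => //; rewrite inE.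
  by move=> /(congr1 val).
have [c0 s0 r0] := fo 0%N isT; have [c1 s1 r1] := fo 1%N isT; have [c2 s2 r2] := fo 2%N isT.
have f01 := fi 0%N 1%N isT isT isT; have f02 := fi 0%N 2%N isT isT isT.
have f12 := fi 1%N 2%N isT isT isT.
rewrite -r0 -r1 -?r2 in f01 f02 f12.
have [e0|n0] := pselect (r c0 = x).
  by exists c1, c2; split => //; rewrite -e0 => /esym.
have [e1|n1] := pselect (r c1 = x).
  by exists c0, c2; split => //; rewrite -e1 => /esym.
by exists c0, c1; split.
Qed.

Lemma small_unit : small x (fun N => copen N /\ N `<=` G0).
Proof.
have [_ oG] := unit_copen g_ample g_unit_compact.
by exists G0; first by split.
Qed.

(** If the range of [b] is not [x], one swap leads from [C] to [B], or two through
[D] when [r b = r c]. If [r b = x], no swap fixing [N] is available; instead the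
difference of the relations for [C] and [D] is swapped with [D] kept fixed. *)
Lemma small_reach (C D B : set G) (c d b : G) : cob g C -> cob g D -> cob g B ->
  C c -> D d -> B b -> s c = x -> s d = x -> s b = x ->
  r c <> x -> r d <> x -> r c <> r d ->
  small x (fun N => forall t, M (delta C N * t) -> M (delta B N * t)).
Proof.
move=> Cc Dc Bc Cc' Dd Bb sc sd sb cx dx cd.
have rx : r x = x by exact: unit_rng.
have Gc : cob g G0 by apply: cob_unit => //; exact: unit_copen.
have step (E F : set G) (e f : G) : cob g E -> cob g F -> E e -> F f -> s e = x ->
    s f = x -> r e <> x -> r f <> x -> r e <> r f ->
    small x (fun N => forall t, M (delta E N * t) -> M (delta F N * t)).
  move=> Ec Fc Ee Ff se sf ex fx ef.
  have H := small_swap Gc Ec Fc xG Ee Ff xG se sf.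
  have xe : r x <> r e by rewrite rx; exact: nesym.
  have xf : r x <> r f by rewrite rx; exact: nesym.
  apply: (small2 (H xe xf ef) small_unit) => N + [_ NG].
  by rewrite (unit_slice NG).
have CD := step C D c d Cc Dc Cc' Dd sc sd cx dx cd.
have [bx|bx] := pselect (r b = x).
  have bd : r b <> r d by rewrite bx => /esym.
  have bc : r b <> r c by rewrite bx => /esym.
  have DCB := small_swap Dc Cc Bc Dd Cc' Bb sd sc sb (nesym cd) (nesym bd) (nesym bc).
  apply: (small2 CD DCB) => N HD HB t tC; have tD := HD t tC.
  have := HB t; rewrite (_ : (chi (slice D N) - chi (slice C N)) * t =
    delta C N * t - delta D N * t); last by ncring.
  move=> /(_ (csubB hM tC tD)) tB.
  rewrite (_ : delta B N * t = delta D N * t + (chi (slice D N) - chi (slice B N)) * t).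
    exact: (csubD hM).
  by ncring.
have [bc|bc] := pselect (r b = r c).
  have db : r d <> r b by rewrite bc; exact: nesym.
  have DB := step D B d b Dc Bc Dd Bb sd sb dx bx db.
  by apply: (small2 CD DB) => N HD HB t /HD/HB.
exact: (step C B c b Cc Bc Cc' Bb sc sb cx bx (nesym bc)).
Qed.

(** [small_reach] moves the left factor of the corner of [augmentation_diag] and,
after taking adjoints, its right factor. *)
Lemma small_corner (B C : set G) (b c : G) : cob g B -> cob g C ->
  B b -> C c -> s b = x -> s c = x ->
  small x (fun N => M (delta B N * star (delta C N))).
Proof.
move=> Bc Cc Bb Cc' sb sc.
have [e [f [se sf ex fx ef]]] := exists_two_arrows.
have [E [Ec Ee] _] := cob_base g_ample g_unit_compact openT (I : setT e).
have [F [Fc Ff] _] := cob_base g_ample g_unit_compact openT (I : setT f).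
have HB := small_reach Ec Fc Bc Ee Ff Bb se sf sb ex fx ef.
have HC := small_reach Ec Fc Cc Ee Ff Cc' se sf sc ex fx ef.
have rx : r x = x by exact: unit_rng.
have Gc : cob g G0 by apply: cob_unit => //; exact: unit_copen.
have GE : small x (fun N => r @` slice G0 N `&` r @` slice E N = set0).
  have := small_disjoint g_ample Gc Ec xG Ee (etrans xG (esym se)).
  by rewrite rx xG; apply; apply: nesym.
have sE : small x (fun N => [/\ copen N, N `<=` G0, cob g (slice E N) & s @` slice E N = N]).
  by apply: (small_src g_ample Ec); exists e.
have S1 := small2 HB HC (fun N p q => conj p q).
have S2 := small2 GE sE (fun N p q => conj p q).
apply: (small2 S1 S2) => N [PB PC] [dE [Nc NG Esc sEN]].
have diag : M (delta E N * star (delta E N)).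
  apply: augmentation_diag => //; rewrite -[X in X `&` _](unit_image_rng NG).
  by rewrite -{1}(unit_slice NG).
apply: PB; have := augmentation_star (PC _ diag).
by rewrite starMr starK.
Qed.

End AtPoint.

Lemma chi_of_sub W N : cob g W -> copen N -> N `<=` G0 -> s @` W = N -> chi W * chi N = chi W.
Proof.
move=> Wc Nc NG sW; rewrite chi_slice//; congr (chi _); apply/seteqP; split=> [y []//|y Wy].
by split => //=; rewrite /preimage /= -sW; exists y.
Qed.

(** For a small piece [B] of [W] with source [N], the product is the difference of the
corners of [small_corner] for the pairs [V W], [V'^-1] and [W], [V'^-1]. *)
Lemma chi_compl V W V' : full V -> full V' -> cob g W -> M ((1 - chi V) * chi W * (1 - chi V')).
Proof.
move=> Vf Vf' Wc; have Vc := full_cob Vf; have Vc' := full_cob Vf'.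
pose P B := B `<=` W -> M ((1 - chi V) * chi B * (1 - chi V')).
suff : P W by apply.
apply: (copen_ind hG (cob_copen Wc)).
- by move=> _; rewrite chi0 mulr0 mul0r; case: hM.
- rewrite /P => B C Bc Cc BC PB PC BCW; rewrite chiU// (mulrDr _ (chi B)) mulrDl.
  by apply: (csubD hM); [apply: PB|apply: PC] => y ?; apply: BCW; [left|right].
move=> w Ww; set x := s w.
have xG : G0 x by exact: src_src.
have [v Vv vw] : (s @` V) (r w) by case: Vf => _ _ _ _ ->; exact: src_rng.
have [v' Vv' v'w] : (r @` V') x by case: Vf' => _ _ _ -> _.
have VWc := cob_mul g_ample Vc Wc.
have ViC := cob_inv g_ample Vc'.
have Vi' : sinv g V' (i v') by rewrite /sinv /= ginvK.
have siv : s (i v') = x by rewrite src_inv.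
have H1 := small_corner xG Wc ViC Ww Vi' erefl siv.
have VWm : sprod g V W (m v w) by exists v, w.
have svw : s (m v w) = x by rewrite src_mul.
have H2 := small_corner xG VWc ViC VWm Vi' svw siv.
have [E [oE Ex] HE] := small2 H1 H2 (fun N p q => conj p q).
have [_ oW] := cob_copen Wc.
have oWE : open (W `&` s @^-1` E).
  by apply: openI => //; apply: open_comp => // ? _; exact: src_continuous.
have [B0 [Bc0 B0w] B0E] := cob_base g_ample g_unit_compact oWE (conj Ww Ex : (W `&` s @^-1` E) w).
exists B0; first by split; [exact: (cob_copen Bc0)|].
move=> B BB0 Bc _; pose N := s @` B.
have BW : B `<=` W by move=> y /BB0/B0E[].
have Bcob := cob_sub Wc BW Bc.
have Nc : copen N by exact: src_copen.
have NG : N `<=` G0 by exact: src_image_unit.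
have NE : N `<=` E by move=> _ [y /BB0/B0E[_ Ey] <-].
have [] := HE N Nc NE.
have WB : slice W N = B.
  apply/seteqP; split=> [y [Wy [z Bz zy]]|y By].
    by rewrite -(cob_srcI Wc (BW _ Bz) Wy zy).
  by split; [exact: BW|exists y].
have Ncob : cob g N by exact: cob_unit.
have cB : chi (slice W N) = chi B by rewrite WB.
have cVB : chi (slice (sprod g V W) N) = chi V * chi B.
  by rewrite -chi_slice// -chiM// -mulrA chi_slice// WB.
have cVi : chi (slice (sinv g V') N) = star (chi V') * chi N.
  by rewrite -chi_slice// -chi_star.
have Bn : chi B * chi N = chi B by exact: chi_of_sub.
have nn : star (chi N) * chi N = chi N by rewrite chi_src// unit_image_src.
have ns : star (chi N) = chi N by rewrite -{1}nn starMr starK nn.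
rewrite cB cVB cVi starB starMr starK ns => M1 M2.
rewrite (_ : _ * _ = (chi N - chi V * chi B) * (chi N - chi N * chi V')
   - (chi N - chi B) * (chi N - chi N * chi V')); first exact: (csubB hM).
have -> : (chi N - chi V * chi B) * (chi N - chi N * chi V')
   - (chi N - chi B) * (chi N - chi N * chi V') =
   chi B * chi N - (chi B * chi N) * chi V' - chi V * (chi B * chi N)
     + chi V * (chi B * chi N) * chi V' by ncring.
by rewrite Bn; ncring.
Qed.

Lemma augmentation_corner a t b : M a -> M b -> M (a * t * b).
Proof.
move=> + Mb; move: a; apply: augmentation_ind.
  have := closed_subspace_mul 1 (t * b) hM.
  rewrite (_ : [set a | _] = [set a : U | M (a * t * b)])//.
  by apply/funext => a /=; rewrite mul1r mulrA.
move=> V Vf /=; move: b Mb; apply: augmentation_ind.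
  have := closed_subspace_mul ((1 - chi V) * t) 1 hM.
  rewrite (_ : [set a | _] = [set b : U | M ((1 - chi V) * t * b)])//.
  by apply/funext => a /=; rewrite mulr1.
move=> V' Vf' /=.
exact: (rho_dense (closed_subspace_mul (1 - chi V) (1 - chi V') hM)
  (fun W Wc => chi_compl Vf Vf' Wc)).
Qed.

Lemma augmentation_hereditary :
  hereditary_cstar_subalgebra (M : set A).
Proof.
have [Mcl M0 Ml] := hM.
split; first split => //.
- exact: augmentation_mul.
- exact: augmentation_star.
move=> a b [x ax] Mb [y ay].
have bE : b = cmul (star x) x + cmul (star y) y by rewrite -ax -ay subrKC.
rewrite bE in Mb; rewrite ax.
exact: (@hereditary_of_corner R A _ _ _ M x y hM augmentation_mul (fun a f b => @augmentation_corner a f b) Mb).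
Qed.

End Corner.

Theorem theorem4p3 (R : realType) (G : topologicalType) (g : groupoid G)
    (g_ample : ample g) (g_unit_compact : compact (unit_space g))
    (g_orbits : forall x, unit_space g x -> `I_3 #<= gorbit g x)
    (A : cstarAlgType R) (iota : (G -> R[i]) -> A)
    (A_full : is_full_groupoid_cstar g iota) :
  hereditary_cstar_subalgebra
    (closed_span [set iota \1_(unit_space g) - iota \1_U
                 | U in topological_full_group g]).
Proof.
have [iota_morph _ iota_dense] := A_full.
exact: (augmentation_hereditary g_ample g_unit_compact g_orbits iota_morph iota_dense).
Qed.
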